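(* Let $D\ge1$, $\sigma>0$, and let $c\le k_d$ ($d=1,\dots,D$) be positive integers. Consider the model $x_d=A_d(\tilde s_d+\epsilon_d)$, $d=1,\dots,D$, where $A_d\in\mathbb{R}^{k_d\times k_d}$ is invertible, $\tilde s_d=(s_0^\top,s_d^\top)^\top$ with $s_0\in\mathbb{R}^c$ (common to all $d$) and $s_d\in\mathbb{R}^{k_d-c}$, $\epsilon_d\sim\mathcal{N}(0,\sigma^2\mathbb{I}_{k_d})$, and all scalar components of $s_0,s_1,\dots,s_D,\epsilon_1,\dots,\epsilon_D$ are mutually independent and $s_0$ has a density $p_{S_0}$. Let $W_d=A_d^{-1}$, and let $\mathcal{L}(W_1,\dots,W_D)=\sum_{i=1}^N\log p_{\mathbf X}(x_1^i,\dots,x_D^i)$ be the log-likelihood of $N$ samples $(x_1^i,\dots,x_D^i)$, $i=1,\dots,N$, where $p_{\mathbf X}$ is the joint density of $(x_1,\dots,x_D)$ under the model with $A_d=W_d^{-1}$. Put $z_d^i=W_dx_d^i=(z_{d,0}^{i\top},z_{d,1}^{i\top})^\top$ with $z_{d,0}^i\in\mathbb{R}^c$, $z_{d,1}^i\in\mathbb{R}^{k_d-c}$, let $Z_{d,0}\in\mathbb{R}^{c\times N}$ be the matrix with columns $z_{d,0}^1,\dots,z_{d,0}^N$, and let $\bar s_0^i=\frac1D\sum_{d=1}^Dz_{d,0}^i$. Then $$\begin{aligned}\mathcal{L}(W_1,\dots,W_D)=&\sum_{i=1}^N\Big(\log f(\bar s_0^i)+\sum_{d=1}^D\log p_{Z_{d,1}}(z_{d,1}^i)\Big)\\&-\frac{1}{2\sigma^2}\sum_{d=1}^D\Big(\operatorname{trace}(Z_{d,0}Z_{d,0}^\top)-\frac1D\sum_{l=1}^D\operatorname{trace}(Z_{d,0}Z_{l,0}^\top)\Big)+N\sum_{d=1}^D\log|W_d|+C,\end{aligned}$$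 where $C$ is a constant not depending on $W_1,\dots,W_D$, $p_{Z_{d,1}}$ is the density of $z_{d,1}:=s_d+\epsilon_{d1}$ (with $\epsilon_{d1}$ the last $k_d-c$ components of $\epsilon_d$), and $$f(\bar s_0)=\int_{\mathbb{R}^c}\exp\Big(-\frac{D\|s_0-\bar s_0\|^2}{2\sigma^2}\Big)p_{S_0}(s_0)\,ds_0.$$
   Context: $|W_d|$ denotes $|\det W_d|$. $\|\cdot\|$ is the Euclidean norm, $\mathbb{I}_k$ the $k\times k$ identity matrix. In the model, the sources additionally have mean $0$, identity covariance and are non-Gaussian ($\mathbb{E}[\tilde s_d]=0$, $\operatorname{Var}[\tilde s_d]=\mathbb{I}_{k_d}$). If $k_d=c$, the factor $p_{Z_{d,1}}$ is taken to be $1$. *)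

(* Defs.v *)
From HB Require Import structures.
From mathcomp Require Import all_boot all_order all_algebra.
From mathcomp Require Import all_classical all_reals all_analysis.

Set Implicit Arguments.
Unset Strict Implicit.
Unset Printing Implicit Defensive.

Import Order.TTheory GRing.Theory Num.Theory.
Import numFieldNormedType.Exports.

Local Open Scope classical_set_scope.
Local Open Scope ring_scope.

(* The sigma-algebra on matrices generated by the entries; on 'cV[R]_n this is
   the Borel sigma-algebra of R^n. *)
Definition measure_matrix_display : measure_display -> measure_display.
Proof. exact. Qed.

Section measurable_matrix.
Context {d} {T : sigmaRingType d} {m n : nat}.

Definition entry_preimages : set_system 'M[T]_(m, n) :=
  \bigcup_(ij in [set: 'I_m * 'I_n])
    preimage_set_system setT (fun A : 'M[T]_(m, n) => A ij.1 ij.2) measurable.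

Let matrix_set0 : <<s entry_preimages >> set0.
Proof. exact: sigma_algebra0. Qed.

Let matrix_setC A : <<s entry_preimages >> A -> <<s entry_preimages >> (~` A).
Proof. exact: sigma_algebraC. Qed.

Let matrix_bigcup (F : _^nat) : (forall i, <<s entry_preimages >> (F i)) ->
  <<s entry_preimages >> (\bigcup_i (F i)).
Proof. exact: sigma_algebra_bigcup. Qed.

HB.instance Definition _ := @isMeasurable.Build (measure_matrix_display d)
  'M[T]_(m, n) <<s entry_preimages >> matrix_set0 matrix_setC matrix_bigcup.

End measurable_matrix.

Lemma measurable_entry d (T : sigmaRingType d) m n (i : 'I_m) (j : 'I_n) :
  measurable_fun [set: 'M[T]_(m, n)] (fun A : 'M[T]_(m, n) => A i j).
Proof.
move=> _ Y mY; apply: sub_sigma_algebra; exists (i, j) => //=.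
by exists Y.
Qed.

Lemma measurable_fun_matrixP d d' (T : measurableType d) (T' : measurableType d')
    m n (f : T -> 'M[T']_(m, n)) :
  measurable_fun setT f <->
  forall i j, measurable_fun setT (fun x => f x i j).
Proof.
split=> [mf i j|mf].
  exact: (measurableT_comp (@measurable_entry _ _ _ _ i j) mf).
apply: (@measurability _ _ _ _ setT f entry_preimages) => //.
move=> _ [_ [[i j] _ [B mB <-]] <-].
by rewrite !setTI; have := mf i j measurableT B mB; rewrite setTI.
Qed.

(* Lebesgue measure on R^n, by recursion on n: the point mass on R^0, and the
   product of the one-dimensional Lebesgue measure with that on R^n, carried to
   R^n.+1 by (a, v) |-> col_mx a v. *)
Section lebesgue_cv.
Context {R : realType}.

Definition cons_cv n (av : R * 'cV[R]_n) : 'cV[R]_n.+1 :=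
  col_mx (const_mx av.1 : 'cV_1) av.2.

Lemma cons_cv0 n (av : R * 'cV[R]_n) : cons_cv av ord0 0 = av.1.
Proof.
rewrite -[RHS](mxE const_mx_key (fun=> fun=> av.1) (0 : 'I_1) (0 : 'I_1)).
rewrite -[RHS](col_mxEu (const_mx av.1 : 'cV_1) av.2).
by rewrite /cons_cv; congr (fun_of_matrix _ _ _); exact/val_inj.
Qed.

Lemma cons_cvS n (av : R * 'cV[R]_n) i : cons_cv av (lift ord0 i) 0 = av.2 i 0.
Proof.
rewrite -[RHS](col_mxEd (const_mx av.1 : 'cV_1)).
by rewrite /cons_cv; congr (fun_of_matrix _ _ _); exact/val_inj.
Qed.

Lemma measurable_cons_cv n : measurable_fun setT (@cons_cv n).
Proof.
apply/measurable_fun_matrixP => i j; rewrite (ord1 j).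
case: (unliftP ord0 i) => [k|] ->; last first.
  by under eq_fun do rewrite cons_cv0; exact: measurable_fst.
under eq_fun do rewrite cons_cvS.
exact: (measurableT_comp (@measurable_entry _ _ _ _ k 0) measurable_snd).
Qed.

Section step.
Local Open Scope ereal_scope.
Context {n : nat} (mu : {sigma_finite_measure set 'cV[R]_n -> \bar R}).

Definition lebesgue_cvS : set 'cV[R]_n.+1 -> \bar R :=
  pushforward (lebesgue_measure \x mu) (@cons_cv n).

Let mcons A : measurable A -> measurable (@cons_cv n @^-1` A).
Proof.
by move=> mA; rewrite -[X in measurable X]setTI; exact: measurable_cons_cv.
Qed.

Let lebesgue_cvS0 : lebesgue_cvS set0 = 0.
Proof. by rewrite /lebesgue_cvS /pushforward preimage_set0 measure0. Qed.

Let lebesgue_cvS_ge0 A : 0 <= lebesgue_cvS A.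
Proof. exact: (measure_ge0 (lebesgue_measure \x mu)). Qed.

Let lebesgue_cvS_sigma_additive : semi_sigma_additive lebesgue_cvS.
Proof.
move=> F mF tF mUF; rewrite /lebesgue_cvS /pushforward preimage_bigcup.
apply: measure_semi_sigma_additive.
- by move=> k; exact: mcons.
- apply/trivIsetP => /= i j _ _ ij; rewrite -preimage_setI.
  by move/trivIsetP : tF => /(_ _ _ _ _ ij) ->//; rewrite preimage_set0.
- by rewrite -preimage_bigcup; exact: mcons.
Qed.

HB.instance Definition _ := isMeasure.Build _ _ _ lebesgue_cvS
  lebesgue_cvS0 lebesgue_cvS_ge0 lebesgue_cvS_sigma_additive.

Lemma lebesgue_cvS_rect (A : set R) (B : set 'cV[R]_n) :
  measurable A -> measurable B ->
  lebesgue_cvS [set v : 'cV[R]_n.+1 |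
    A (v ord0 0%R) /\ B (\col_i v (lift ord0 i) 0%R)] =
  lebesgue_measure A * mu B.
Proof.
move=> mA mB; rewrite -product_measure1E//; congr ((lebesgue_measure \x mu) _).
apply/seteqP; split=> -[a v] /=; rewrite cons_cv0;
  rewrite (_ : \col_i _ = v)//;
  by apply/colP => i; rewrite mxE cons_cvS.
Qed.

Let lebesgue_cvS_sigma_finite : sigma_finite setT lebesgue_cvS.
Proof.
have /sigma_finiteP[F [TF ndF Foo]] := sigma_finiteT (@lebesgue_measure R).
have /sigma_finiteP[G [TG ndG Goo]] := sigma_finiteT mu.
pose h (v : 'cV[R]_n.+1) : R * 'cV[R]_n :=
  (v ord0 0%R, \col_i v (lift ord0 i) 0%R).
have mh : measurable_fun setT h.
  apply/measurable_fun_pairP; split; first exact: measurable_entry.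
  apply/measurable_fun_matrixP => i j.
  under eq_fun do rewrite /= mxE.
  exact: measurable_entry.
exists (fun k => h @^-1` (F k `*` G k)).
  apply/esym; rewrite -subTset => v _.
  have [k _ Fk] : (\bigcup_i F i) (h v).1 by rewrite -TF.
  have [l _ Gl] : (\bigcup_i G i) (h v).2 by rewrite -TG.
  exists (maxn k l) => //; split.
    by move: Fk; apply/subsetPset/ndF/leq_maxl.
  by move: Gl; apply/subsetPset/ndG/leq_maxr.
move=> k; have [mF Foo_] := Foo k; have [mG Goo_] := Goo k; split.
  by rewrite -[X in measurable X]setTI; apply: mh => //; exact: measurableX.
rewrite [X in X < _](lebesgue_cvS_rect mF mG).
by rewrite lte_mul_pinfty// ge0_fin_numE.
Qed.

HB.instance Definition _ := Measure_isSigmaFinite.Build _ _ _ lebesgue_cvS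
  lebesgue_cvS_sigma_finite.

End step.

Fixpoint lebesgue_cv n : {sigma_finite_measure set 'cV[R]_n -> \bar R} :=
  match n with
  | 0 => dirac (0 : 'cV[R]_0)
  | n.+1 => lebesgue_cvS (lebesgue_cv n)
  end.

Lemma lebesgue_cv_box n (A : 'I_n -> set R) : (forall i, measurable (A i)) ->
  lebesgue_cv n [set v : 'cV[R]_n | forall i, A i (v i 0)] =
  (\prod_(i < n) lebesgue_measure (A i))%E.
Proof.
elim: n A => [|n IHn] A mA.
  by rewrite big_ord0 /= diracE mem_set// => -[].
have mB : measurable [set v : 'cV[R]_n | forall i, A (lift ord0 i) (v i 0)].
  rewrite (_ : mkset _ = \big[setI/setT]_(i < n)
      ((fun v : 'cV[R]_n => v i 0) @^-1` A (lift ord0 i))).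
    apply: bigsetI_measurable => i _; rewrite -[X in measurable X]setTI.
    exact: measurable_entry.
  rewrite -bigcap_seq; apply/seteqP; split=> v /= Av i; first by move=> _; exact: Av.
  by apply: Av => /=; rewrite mem_index_enum.
rewrite big_ord_recl -IHn// -lebesgue_cvS_rect//=; congr (lebesgue_cvS _ _).
apply/seteqP; split=> v /=.
  by move=> Av; split=> [|i]; rewrite ?mxE.
move=> [A0 AS] i; case: (unliftP ord0 i) => [k|] -> //.
by have := AS k; rewrite mxE.
Qed.

End lebesgue_cv.

Definition enorm {R : realType} {n : nat} (v : 'cV[R]_n) : R :=
  Num.sqrt (\sum_i v i 0 ^+ 2).

Section probability_notions.
Context {R : realType} {d : measure_display} {Omega : measurableType d}.
Variable P : probability Omega R.

(* p is a version of the density of X with respect to Lebesgue measure. *)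
Definition is_density {n : nat} (X : Omega -> 'cV[R]_n) (p : 'cV[R]_n -> R) :=
  [/\ measurable_fun setT p, (forall x, 0 <= p x) &
      forall A, measurable A ->
        P (X @^-1` A) = (\int[lebesgue_cv n]_(x in A) (p x)%:E)%E].

(* X ~ N(mu, tau^2), with tau the standard deviation. *)
Definition is_gaussian (X : Omega -> R) (mu tau : R) : Prop :=
  forall A, measurable A -> P (X @^-1` A) = normal_prob mu tau A.

Definition mutually_independent {J : finType} (X : J -> Omega -> R) : Prop :=
  forall (K : {set J}) (B : J -> set R), (forall j, measurable (B j)) ->
    P (\bigcap_(j in [set` K]) X j @^-1` B j) =
    (\prod_(j in K) P (X j @^-1` B j))%E.

End probability_notions.

(* The d-th view has dimension k_d = c + m d: c shared sources s0, m d
   individual sources s d, and c + m d noise variables eps d. *)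
Section model.
Context {R : realType} {D c : nat} {m : 'I_D -> nat}.
Context {dO : measure_display} {Omega : measurableType dO}.
Variables (P : probability Omega R).
Variables (s0 : {RV P >-> 'cV[R]_c}) (s : forall d, {RV P >-> 'cV[R]_(m d)}).
Variable eps : forall d, {RV P >-> 'cV[R]_(c + m d)}.

Definition stilde (d : 'I_D) (w : Omega) : 'cV[R]_(c + m d) :=
  col_mx (s0 w) (s d w).

Definition scalar_component
    (j : ('I_c + {d : 'I_D & 'I_(m d)}) + {d : 'I_D & 'I_(c + m d)}) :
    Omega -> R :=
  match j with
  | inl (inl a) => fun w => s0 w a 0
  | inl (inr da) => fun w => s (tag da) w (tagged da) 0
  | inr da => fun w => eps (tag da) w (tagged da) 0
  end.

(* Together with independence, eps_gaussian says eps d ~ N(0, sigma^2 I). *)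
Record multiview_model (sigma : R) : Prop := MultiviewModel {
  components_independent : mutually_independent P scalar_component;
  eps_gaussian : forall d a, is_gaussian P (fun w => eps d w a 0) 0 sigma;
  sources_centered : forall d a, ('E_P[fun w => stilde d w a 0%R] = 0)%E;
  sources_white : forall d a b,
    covariance P (fun w => stilde d w a 0) (fun w => stilde d w b 0) =
    ((a == b)%:R)%:E;
  sources_non_gaussian : forall d a mu tau, 0 < tau ->
    ~ is_gaussian P (fun w => stilde d w a 0) mu tau
}.

(* The joint observation (x_1, ..., x_D), x_d = A_d (stilde_d + eps_d). *)
Definition observation (A : forall d, 'M[R]_(c + m d)) (w : Omega) :
    'cV[R]_(\sum_d (c + m d)) :=
  \mxcol_d (A d *m (stilde d w + eps d w)).

Definition noisy_individual (d : 'I_D) (w : Omega) : 'cV[R]_(m d) :=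
  s d w + dsubmx (eps d w).

End model.

(* The joint density p is a function of the stacked vector (x_1, ..., x_D). *)
Definition log_likelihood {R : realType} {D : nat} {k : 'I_D -> nat} {N : nat}
    (p : 'cV[R]_(\sum_d k d) -> R) (x : 'I_N -> forall d, 'cV[R]_(k d)) : R :=
  \sum_(i < N) ln (p (\mxcol_d x i d)).

Definition shared_factor {R : realType} (D c : nat) (sigma : R)
    (pS0 : 'cV[R]_c -> R) (sbar : 'cV[R]_c) : R :=
  \int[lebesgue_cv c]_s0
    (expR (- (D%:R * enorm (s0 - sbar) ^+ 2 / (2 * sigma ^+ 2))) * pS0 s0).

Section unmixing.
Context {R : realType} {D c : nat} {m : 'I_D -> nat} {N : nat}.
Variables (W : forall d, 'M[R]_(c + m d)).
Variable x : 'I_N -> forall d, 'cV[R]_(c + m d).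

Definition z_shared (d : 'I_D) (i : 'I_N) : 'cV[R]_c := usubmx (W d *m x i d).

Definition z_individual (d : 'I_D) (i : 'I_N) : 'cV[R]_(m d) :=
  dsubmx (W d *m x i d).

Definition Z_shared (d : 'I_D) : 'M[R]_(c, N) :=
  \matrix_(a, i) z_shared d i a 0.

Definition sbar (i : 'I_N) : 'cV[R]_c := D%:R^-1 *: \sum_d z_shared d i.

End unmixing.

(* Main.v *)
Require Import Defs.
From HB Require Import structures.
From mathcomp Require Import all_boot all_order all_algebra all_fingroup.
From mathcomp Require Import all_classical all_reals all_analysis measurable_realfun.
From mathcomp Require Import ring lra.

Set Implicit Arguments.
Unset Strict Implicit.
Unset Printing Implicit Defensive.

Import Order.TTheory GRing.Theory Num.Theory.
Import numFieldNormedType.Exports.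

Local Open Scope classical_set_scope.
Local Open Scope ring_scope.

(* Write z_d = W_d x_d. Under the model the stacked vector of the z_d is T + E,
   with E a vector of independent N(0, sigma^2) variables independent of the
   source vector T, so its density at z is g(z) = E[prod_i phi(z_i - T_i)].
   This needs no density for the individual sources, and g is continuous and
   everywhere positive. Since the scalar sources are independent, g factors as
   E[prod_(a, d) phi(z_da - s0_a)] * prod_d h_d(z_d1), where h_d is the same
   expression for s_d + eps_d1 and thus a version of the density p_{Z_d1}.
   Completing the square in sum_d |z_d0 - s_0|^2 turns the first factor into
   f(mean of the z_d0) times a Gaussian weight in the scatter of the z_d0
   around their mean, and the change of variables z_d = W_d x_d brings in
   prod_d |det W_d|. Densities being unique only almost everywhere, the
   exceptional set is where p_X or some p_{Z_d1} differs from these versions;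
   it is null because the density of x is positive, and empty when p_X and the
   p_{Z_d1} are continuous. *)

(** * Boxes in R^n and affine maps of the line *)

Section box.
Context {R : realType} {n : nat}.
Implicit Type A : 'I_n -> set R.

Definition box A : set 'cV[R]_n := [set v | forall i, A i (v i 0)].

Lemma boxE A :
  box A = \big[setI/setT]_(i < n) ((fun v : 'cV[R]_n => v i 0) @^-1` A i).
Proof.
rewrite -bigcap_seq; apply/seteqP; split=> v /= Av i; first by move=> _; exact: Av.
by apply: Av => /=; rewrite mem_index_enum.
Qed.

Lemma measurable_box A : (forall i, measurable (A i)) -> measurable (box A).
Proof.
move=> mA; rewrite boxE; apply: bigsetI_measurable => i _.
by rewrite -[X in measurable X]setTI; exact: measurable_entry.
Qed.

Lemma measurable_cvE : @measurable _ 'cV[R]_n =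
  <<s [set box A | A in [set A | forall i, measurable (A i)]] >>.
Proof.
apply/seteqP; split.
  apply: smallest_sub; first exact: smallest_sigma_algebra.
  move=> _ [[i j] _ [B mB <-]]; apply: sub_sigma_algebra; rewrite setTI /=.
  exists (fun k => if k == i then B else setT) => [k|]; first by case: ifP.
  apply/seteqP; split=> v /=; rewrite (ord1 j).
    by move=> /(_ i); rewrite eqxx.
  by move=> Bv k; case: eqP => // ->.
apply: smallest_sub; first exact: sigma_algebra_measurable.
by move=> _ [A mA <-]; exact: measurable_box.
Qed.

(** Boxes are stable under intersection and generate the sigma-algebra, and the cubes with sides
    [[- k, k]] exhaust the space, so the uniqueness theorem for measures applies. Translations,
    permutations, independence and densities are all reduced to boxes in this way. *)
Lemma box_measure_unique (mu nu : {measure set 'cV[R]_n -> \bar R}) :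
  (forall A, (forall i, measurable (A i)) -> mu (box A) = nu (box A)) ->
  (forall k : nat, (mu (box (fun=> `[(- k%:R)%R, k%:R%R]%classic)) < +oo)%E) ->
  forall B, measurable B -> mu B = nu B.
Proof.
move=> munu muoo.
apply: (measure_unique [set box A | A in [set A | forall i, measurable (A i)]]
  (fun k : nat => box (fun=> `[- k%:R, k%:R]%classic))) => //.
- exact: measurable_cvE.
- move=> _ _ [A mA <-] [B mB <-]; exists (fun i => A i `&` B i).
    by move=> i; exact: measurableI.
  by apply/seteqP; split=> [v ABv|v [Av Bv] i]; split=> // i; case: (ABv i).
- by move=> k; exists (fun=> `[- k%:R, k%:R]%classic).
- rewrite -subTset => v _.
  (* The l1 norm of [v] dominates every coordinate, so the next integer is the half-side of a cube
     containing [v]. *)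
  exists (Num.truncn (\sum_i `|v i 0|)).+1 => //= i.
  rewrite /= in_itv/= -ler_norml; apply: ltW; apply: le_lt_trans (truncnS_gt _).
  by rewrite (bigD1 i)//= lerDl sumr_ge0.
- by move=> _ [A mA <-]; exact: munu.
Qed.

Lemma lebesgue_cv_box_lty (a b : R) :
  (lebesgue_cv n (box (fun=> `[a, b]%classic)) < +oo)%E.
Proof.
rewrite lebesgue_cv_box// -ge0_fin_numE; last by apply: prode_ge0.
apply: prode_fin_num => i _; rewrite lebesgue_measure_itv/=.
by case: ifP.
Qed.

End box.

Section lebesgue_affine1.
Context {R : realType}.
Implicit Types (a : R) (A : set R).

Lemma lebesgue_measure_shift a A : measurable A ->
  lebesgue_measure [set x | A (a + x)] = lebesgue_measure A.
Proof.
move=> mA; apply/esym.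
have ma : @measurable_fun _ _ (measurableTypeR R) (measurableTypeR R) setT (fun x => a + x).
  by apply: measurable_funD => //; exact: measurable_cst.
pose phi : {mfun measurableTypeR R >-> measurableTypeR R} :=
  HB.pack (fun x : R => a + x) (isMeasurableFun.Build _ _ _ _ _ ma).
apply: (@lebesgue_measure_unique R (pushforward lebesgue_measure phi) _ A mA).
move=> _ [[x y]] _ <-.
rewrite [RHS](_ : _ = lebesgue_measure `](x - a), (y - a)]%classic); last first.
  congr lebesgue_measure; apply/seteqP.
  by split=> z; rewrite /= !in_itv/= ltrBlDl lerBrDl.
rewrite !lebesgue_measure_itv/= !lte_fin ltrD2r; case: ifP => // _.
by rewrite -!EFinB; congr (_ %:E); ring.
Qed.

Lemma lebesgue_measure_scale a A : a != 0 -> measurable A ->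
  (`|a|%:E * lebesgue_measure [set x | A (a * x)%R] = lebesgue_measure A)%E.
Proof.
move=> a0 mA; apply/esym.
have ma : @measurable_fun _ _ (measurableTypeR R) (measurableTypeR R) setT (fun x => a * x).
  by apply: measurable_funM => //; exact: measurable_cst.
pose phi : {mfun measurableTypeR R >-> measurableTypeR R} :=
  HB.pack (fun x : R => a * x) (isMeasurableFun.Build _ _ _ _ _ ma).
apply: (@lebesgue_measure_unique R
  (mscale (NngNum (normr_ge0 a)) (pushforward lebesgue_measure phi)) _ A mA).
move=> _ [[x y]] _ <-.
rewrite /mscale [X in _ = (_ * X)%E](_ : _ =
  lebesgue_measure [set z | x < a * z <= y]); last first.
  by congr lebesgue_measure; apply/seteqP; split=> z; rewrite /= in_itv.
(* For negative [a] the preimage of a left-open interval is right-open; its length is not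
   affected. *)
case: (ltgtP a 0) a0 => // a0 _.
  rewrite (_ : [set z | x < a * z <= y] = `[(y / a), (x / a)[%classic); last first.
    by apply/seteqP; split=> z; rewrite /= !in_itv/= ltr_ndivlMr// ler_ndivrMr// (mulrC z) andbC.
  rewrite !lebesgue_measure_itv/= !lte_fin ltr_nM2r ?invr_lt0//.
  case: ifP => _; rewrite ?mule0// -!EFinB -EFinM; congr (_ %:E).
  by rewrite /= ltr0_norm// mulNr mulrBr !(mulrC a) !divfK ?lt_eqF// opprB.
rewrite (_ : [set z | x < a * z <= y] = `](x / a), (y / a)]%classic); last first.
  by apply/seteqP; split=> z; rewrite /= !in_itv/= ltr_pdivrMr// ler_pdivlMr// (mulrC z).
rewrite !lebesgue_measure_itv/= !lte_fin ltr_pM2r ?invr_gt0//.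
case: ifP => _; rewrite ?mule0// -!EFinB -EFinM; congr (_ %:E).
by rewrite /= gtr0_norm// mulrBr !(mulrC a) !divfK ?gt_eqF.
Qed.

End lebesgue_affine1.

(** * Linear change of variables in R^n *)

(** The second hypothesis makes [nu] equal to [k] times the pushforward of [mu], so the rules for
    pushforwards and scaled measures combine. It serves with [k] the modulus of a determinant for
    linear maps, and with 1 for translations. *)
Lemma ge0_integral_image d1 d2 (T1 : measurableType d1) (T2 : measurableType d2)
    (R : realType) (mu : {measure set T1 -> \bar R})
    (nu : {measure set T2 -> \bar R}) (k : {nonneg R}) (phi : T1 -> T2)
    (D : set T2) (f : T2 -> \bar R) :
  measurable_fun setT phi ->
  (forall A, measurable A -> k%:num%:E * mu (phi @^-1` A) = nu A)%E ->
  measurable D -> measurable_fun setT f -> (forall x, 0 <= f x)%E ->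
  (k%:num%:E * \int[mu]_(x in phi @^-1` D) f (phi x) = \int[nu]_(y in D) f y)%E.
Proof.
move=> mphi kmu mD mf f0.
pose mu' : {measure set T2 -> \bar R} := pushforward mu phi.
transitivity (k%:num%:E * \int[mu' mphi]_(y in D) f y)%E.
  by rewrite [in RHS]ge0_integral_pushforward//; exact: measurable_funTS.
rewrite -ge0_integral_mscale//; last exact: measurable_funTS.
by apply: eq_measure_integral => A mA _; rewrite -kmu.
Qed.

Lemma measurable_mulmx {R : realType} m n (M : 'M[R]_(m, n)) :
  measurable_fun setT (mulmx M : 'cV[R]_n -> 'cV[R]_m).
Proof.
apply/measurable_fun_matrixP => i j.
under eq_fun do rewrite mxE.
apply: measurable_sum => k; apply: measurable_funM; first exact: measurable_cst.
exact: measurable_entry.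
Qed.

Lemma measurable_addmx {R : realType} n (u : 'cV[R]_n) :
  measurable_fun setT (fun v : 'cV[R]_n => u + v).
Proof.
apply/measurable_fun_matrixP => i j.
under eq_fun do rewrite mxE.
by apply: measurable_funD; [exact: measurable_cst|exact: measurable_entry].
Qed.

Section linear_image.
Context {R : realType}.

Lemma lebesgue_cv_shift n (u : 'cV[R]_n) (B : set 'cV[R]_n) : measurable B ->
  lebesgue_cv n [set v | B (u + v)] = lebesgue_cv n B.
Proof.
move=> mB; pose phi : {mfun 'cV[R]_n >-> 'cV[R]_n} :=
  HB.pack (fun v => u + v) (isMeasurableFun.Build _ _ _ _ _ (measurable_addmx u)).
apply/esym.
apply: (box_measure_unique (nu := pushforward (lebesgue_cv n) phi)) => //.
  move=> A mA; transitivity (\prod_(i < n) lebesgue_measure (A i))%E.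
    exact: lebesgue_cv_box.
  rewrite [RHS](_ : _ = lebesgue_cv n (box (fun i => [set x | A i (u i 0 + x)]))).
    rewrite lebesgue_cv_box//.
      by apply: eq_bigr => i _; rewrite lebesgue_measure_shift.
    move=> i; rewrite -[X in measurable X]setTI.
    have : measurable_fun setT (fun x : R => u i 0 + x).
      by apply: measurable_funD => //; exact: measurable_cst.
    exact.
  congr (lebesgue_cv n _).
  by apply/seteqP; split=> v Av i; move: (Av i); rewrite /= mxE.
by move=> k; exact: lebesgue_cv_box_lty.
Qed.

(** Formulated with preimages, which are measurable for any [M], and with a factor instead of a
    quotient; the property is then directly multiplicative in [M]. *)
Definition scales_volume n (M : 'M[R]_n) := forall B, measurable B ->
  (`|\det M|%:E * lebesgue_cv n [set v | B (M *m v)])%E = lebesgue_cv n B.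

Lemma scales_volumeM n (M M' : 'M[R]_n) :
  scales_volume M -> scales_volume M' -> scales_volume (M *m M').
Proof.
move=> sM sM' B mB; rewrite det_mulmx normrM EFinM -muleA.
under eq_set do rewrite -mulmxA.
rewrite [X in (_ * X)%E](sM' [set v | B (M *m v)]) ?sM//.
by rewrite -[X in measurable X]setTI; exact: measurable_mulmx.
Qed.

(** The preimage of a box is a box with permuted sides, and the determinant is a sign. *)
Lemma scales_volume_perm n (s : {perm 'I_n}) : scales_volume (perm_mx s).
Proof.
move=> B mB; rewrite det_perm normrX normrN1 expr1n mul1e.
pose phi : {mfun 'cV[R]_n >-> 'cV[R]_n} := HB.pack (mulmx (perm_mx s))
  (isMeasurableFun.Build _ _ _ _ _ (measurable_mulmx (perm_mx s))).
apply/esym.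
apply: (box_measure_unique (nu := pushforward (lebesgue_cv n) phi)) => //.
  move=> A mA; transitivity (\prod_(i < n) lebesgue_measure (A i))%E.
    exact: lebesgue_cv_box.
  rewrite [RHS](_ : _ = lebesgue_cv n (box (fun i => A ((s^-1)%g i)))).
    rewrite lebesgue_cv_box// (reindex_inj (@perm_inj _ s^-1)).
    by apply: eq_bigr.
  congr (lebesgue_cv n _); apply/seteqP; split=> v Av i; move: (Av).
    by move=> /(_ ((s^-1)%g i)); rewrite /= -row_permE mxE permKV.
  by move=> /(_ (s i)); rewrite /= -row_permE mxE permK.
by move=> k; exact: lebesgue_cv_box_lty.
Qed.

Lemma lebesgue_cvSE n (B : set 'cV[R]_n.+1) : lebesgue_cv n.+1 B =
  (\int[lebesgue_measure]_x lebesgue_cv n [set v | B (cons_cv (x, v))])%E.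
Proof.
rewrite /= /lebesgue_cvS /pushforward /product_measure1.
apply: eq_integral => x _ /=; congr (lebesgue_cv n _).
by apply/seteqP; split => v; rewrite /xsection/= inE.
Qed.

Lemma measurable_cons_section n (B : set 'cV[R]_n.+1) x : measurable B ->
  measurable [set v | B (cons_cv (x, v))].
Proof.
move=> mB; rewrite -[X in measurable X]setTI.
apply: (measurableT_comp (@measurable_cons_cv R n)) => //.
Qed.

Lemma measurable_lebesgue_cons_section n (B : set 'cV[R]_n.+1) : measurable B ->
  measurable_fun setT (fun x => lebesgue_cv n [set v | B (cons_cv (x, v))]).
Proof.
move=> mB.
have mB' : measurable (@cons_cv R n @^-1` B).
  by rewrite -[X in measurable X]setTI; exact: measurable_cons_cv.
have := measurable_fun_xsection (lebesgue_cv n) mB'.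
apply: eq_measurable_fun => x _ /=; congr (lebesgue_cv n _).
by apply/seteqP; split => v; rewrite /xsection/= inE.
Qed.

Lemma ge0_integral_scale (a : R) (f : measurableTypeR R -> \bar R) : a != 0 ->
  measurable_fun setT f -> (forall x, 0 <= f x)%E ->
  (`|a|%:E * \int[lebesgue_measure]_x f (a * x)%R =
   \int[lebesgue_measure]_x f x)%E.
Proof.
move=> a0 mf f0.
have ma : @measurable_fun _ _ (measurableTypeR R) (measurableTypeR R) setT
  (fun x => a * x).
  by apply: measurable_funM => //; exact: measurable_cst.
have := ge0_integral_image (mu := lebesgue_measure) (nu := lebesgue_measure)
  (k := NngNum (normr_ge0 a)) ma _ measurableT mf => /= <- //.
by move=> A mA; rewrite -(lebesgue_measure_scale a0 mA).
Qed.

Lemma mul_lblock_cons n (a : R) (c : 'cV[R]_n) (M : 'M[R]_n) x v :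
  (block_mx a%:M 0 c M : 'M[R]_(1 + n)) *m cons_cv (x, v) =
  cons_cv (a * x, x *: c + M *m v).
Proof.
rewrite /cons_cv mul_block_col mul0mx addr0 /=; congr col_mx.
  by apply/matrixP => i j; rewrite mul_scalar_mx !mxE.
by congr (_ + _); apply/colP => i; rewrite !mxE big_ord1 !mxE mulrC.
Qed.

(** Induction on the dimension, slicing along the first coordinate. A lower triangular matrix sends
    [(x, v)] to [(a x, x c + M' v)]: on the slice with [x] fixed, [M'] scales the volume by the
    induction hypothesis and the shift by [x c] preserves it, while the outer integral is rescaled
    by [a]. *)
Lemma scales_volume_trig n (M : 'M[R]_n) :
  is_trig_mx M -> \det M != 0 -> scales_volume M.
Proof.
elim: n M => [|n IHn] M.
  move=> _ _ B mB; rewrite det_mx00 normr1 mul1e; congr (lebesgue_cv 0 _).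
  by apply/seteqP; split=> v /=; rewrite [_ *m v]flatmx0 [v]flatmx0.
rewrite -[M](submxK (m1 := 1) (n1 := 1)).
set a := ulsubmx _; set r := ursubmx _; set c := dlsubmx _; set M' := drsubmx _.
rewrite (mx11_scalar a) => /is_trig_mxP trM.
have -> : r = 0.
  apply/matrixP => i j.
  transitivity (block_mx (a 0 0)%:M r c M' (lshift n i) (rshift 1 j)).
    by rewrite block_mxEur.
  by rewrite trM ?mxE//= ord1.
have trM' : is_trig_mx M'.
  apply/is_trig_mxP => i j ij.
  transitivity (block_mx (a 0 0)%:M r c M' (rshift 1 i) (rshift 1 j)).
    by rewrite block_mxEdr.
  by rewrite trM//= !ltnS.
have detE : \det (block_mx (a 0 0)%:M 0 c M' : 'M[R]_n.+1) = a 0 0 * \det M'.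
  by rewrite [LHS](det_lblock (a 0 0)%:M c M') det_scalar expr1.
rewrite detE mulf_eq0 negb_or => /andP[a0 detM'].
move=> B mB; rewrite detE normrM EFinM -muleA.
rewrite lebesgue_cvSE -ge0_integralZl//; last first.
  apply: measurable_lebesgue_cons_section.
  by rewrite -[X in measurable X]setTI; exact: measurable_mulmx.
rewrite lebesgue_cvSE -(@ge0_integral_scale (a 0 0))//; last first.
  exact: measurable_lebesgue_cons_section.
congr (_ * _)%E; apply: eq_integral => x _.
pose S := [set u | B (cons_cv (a 0 0 * x, u))].
have mS : measurable S by exact: measurable_cons_section.
rewrite [X in (_ * lebesgue_cv n X)%E](_ : _ = [set v | S (x *: c + M' *m v)]).
  rewrite -[RHS](lebesgue_cv_shift (x *: c) mS).
  apply: (IHn M' trM' detM' [set u | S (x *: c + u)]).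
  by rewrite -[X in measurable X]setTI; exact: measurable_addmx.
by apply/seteqP; split=> v /=; rewrite (mul_lblock_cons (a 0 0) c M' x v).
Qed.

(** The LUP decomposition writes [M] as a product of a permutation, a lower triangular matrix of
    determinant 1 and an upper triangular one. *)
Lemma scales_volume_unitmx n (M : 'M[R]_n) : M \in unitmx -> scales_volume M.
Proof.
(* Dimension 0 is separate because [cormen_lup] acts on matrices of successor size. *)
case: n M => [|n] M.
  move=> _; apply: scales_volume_trig; last by rewrite det_mx00 oner_eq0.
  by apply/is_trig_mxP => -[].
rewrite unitmxE unitfE.
have := cormen_lup_correct M; have := cormen_lup_perm M.
have := cormen_lup_detL M; have := cormen_lup_lower M.
have := @cormen_lup_upper _ _ M.
case: (cormen_lup M) => [[Q L] U]/= Uu Ll dL /is_perm_mxP[s ->{Q}] PLU.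
have {PLU}-> : M = perm_mx s^-1 *m (L *m U).
  by rewrite -[_ *m U]PLU mulmxA -perm_mxM mulVg perm_mx1 mul1mx.
have sL : scales_volume L.
  apply: scales_volume_trig; last by rewrite dL oner_eq0.
  apply/is_trig_mxP => i j ij; rewrite Ll; last exact: ltnW.
  by case: eqP ij => // ->; rewrite ltnn.
move=> detM; apply: scales_volumeM; first exact: scales_volume_perm.
apply: scales_volumeM => //.
have detU : \det U != 0.
  by move: detM; rewrite !det_mulmx !mulf_eq0 !negb_or => /and3P[].
(* Conjugation by the reversal of the coordinates turns [U] into a lower triangular matrix. *)
pose t := perm (@rev_ord_inj n.+1).
pose L' := \matrix_(i, j) U (t i) (t j).
have UE : U = perm_mx t *m (L' *m perm_mx t^-1).
  by rewrite -row_permE -col_permE; apply/matrixP => i j; rewrite !mxE !permE !rev_ordK.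
rewrite UE; apply: scales_volumeM; first exact: scales_volume_perm.
apply: scales_volumeM; last exact: scales_volume_perm.
apply: scales_volume_trig.
  apply/is_trig_mxP => i j ij; rewrite !mxE Uu// !permE /=.
  by apply: ltn_sub2l => //; exact: leq_ltn_trans ij (ltn_ord j).
by move: detU; rewrite UE !det_mulmx !mulf_eq0 !negb_or => /and3P[].
Qed.

Lemma ge0_integral_mulmx n (M : 'M[R]_n) (D : set 'cV[R]_n)
    (f : 'cV[R]_n -> \bar R) :
  M \in unitmx -> measurable D -> measurable_fun setT f -> (forall x, 0 <= f x)%E ->
  (`|\det M|%:E * \int[lebesgue_cv n]_(v in [set v | D (M *m v)]) f (M *m v) =
   \int[lebesgue_cv n]_(v in D) f v)%E.
Proof.
move=> /scales_volume_unitmx sM mD mf f0.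
have := ge0_integral_image (mu := lebesgue_cv n) (nu := lebesgue_cv n)
  (k := NngNum (normr_ge0 (\det M))) (measurable_mulmx M) _ mD mf f0.
by apply => A mA; exact: sM.
Qed.

End linear_image.

(** * Measures with a density and independent pairs *)

Section density_measure.
Context d (T : measurableType d) (R : realType).
Variables (mu : {measure set T -> \bar R}) (p : T -> R).
Hypotheses (mp : measurable_fun setT p) (p0 : forall x, 0 <= p x).
Local Open Scope ereal_scope.

(* The proofs are phantom arguments, from which the measure instance is inferred. *)
Definition density_measure of measurable_fun setT p & (forall x, 0 <= p x)%R :=
  fun A : set T => \int[mu]_(x in A) (p x)%:E.

Let density_measure0 : density_measure mp p0 set0 = 0.
Proof. by rewrite /density_measure integral_set0. Qed.

Let density_measure_ge0 A : 0 <= density_measure mp p0 A.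
Proof. by apply: integral_ge0 => x _; rewrite lee_fin. Qed.

Let density_measure_sigma_additive : semi_sigma_additive (density_measure mp p0).
Proof.
move=> F mF tF mUF; rewrite /density_measure.
rewrite ge0_integral_bigcup//.
- apply: is_cvg_ereal_nneg_natsum_cond => n _ _.
  by apply: integral_ge0 => x _; rewrite lee_fin.
- exact/measurable_EFinP/measurable_funTS.
- by move=> x _; rewrite lee_fin.
Qed.

HB.instance Definition _ := isMeasure.Build _ _ _ (density_measure mp p0)
  density_measure0 density_measure_ge0 density_measure_sigma_additive.

End density_measure.

Section integral_density.
Context d (T : measurableType d) (R : realType).
Variables (mu nu : {measure set T -> \bar R}) (p : T -> R).
Hypotheses (mp : measurable_fun setT p) (p0 : forall x, 0 <= p x).
Hypothesis nuE : forall A, measurable A -> (nu A = \int[mu]_(x in A) (p x)%:E)%E.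
Local Open Scope ereal_scope.
Import HBNNSimple.

(** Both sides are limits, by monotone convergence, along simple functions approximating [f]; on the
    indicator of a level set the identity is [nuE]. *)
Lemma ge0_integral_density (f : T -> \bar R) :
  measurable_fun setT f -> (forall x, 0 <= f x) ->
  \int[nu]_x f x = \int[mu]_x (f x * (p x)%:E).
Proof.
move=> mf f0; pose f_ := nnsfun_approx measurableT mf.
transitivity (limn (fun n => \int[nu]_x (f_ n x)%:E)).
  rewrite -monotone_convergence//=.
  - apply: eq_integral => ? /[!inE] xD; apply/esym/cvg_lim => //=.
    exact: cvg_nnsfun_approx.
  - by move=> n; exact/measurable_EFinP/measurable_funTS.
  - by move=> n ? _; rewrite lee_fin.
  - by move=> ? _ ? ? mn; rewrite lee_fin; exact/lefP/nd_nnsfun_approx.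
rewrite [RHS](_ : _ = limn (fun n => \int[mu]_x ((f_ n x)%:E * (p x)%:E))).
  apply: congr_lim; apply/funext => n.
  under eq_integral do rewrite fimfunE -fsumEFin//.
  rewrite ge0_integral_fsum//; last 2 first.
  - by move=> r; exact/measurable_EFinP/measurableT_comp.
  - by move=> r x _; rewrite EFinM nnfun_muleindic_ge0.
  under [RHS]eq_integral.
    move=> x _; rewrite fimfunE -fsumEFin// ge0_mule_fsuml; last first.
      by move=> r; rewrite EFinM nnfun_muleindic_ge0.
    over.
  rewrite [RHS]ge0_integral_fsum//; last 2 first.
  - move=> r; apply: emeasurable_funM; last exact/measurable_EFinP.
    exact/measurable_EFinP/measurableT_comp.
  - by move=> r x _; rewrite mule_ge0// ?EFinM ?nnfun_muleindic_ge0// lee_fin.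
  apply: eq_fsbigr => r _; rewrite integralZl_indic_nnsfun// integral_indic//= setIT.
  rewrite nuE//.
  (* A nonnegative simple function never takes a negative value [r], so both sides vanish there. *)
  have [r0|r0] := leP 0%R r; last first.
    rewrite preimage_nnfun0// integral_set0 mule0 integral0_eq// => x _.
    by rewrite indic0 mulr0 mul0e.
  under [RHS]eq_integral do rewrite EFinM -muleA.
  rewrite ge0_integralZl//; last 2 first.
  - apply: emeasurable_funM; last exact/measurable_EFinP.
    exact/measurable_EFinP.
  - by move=> x _; rewrite mule_ge0 ?lee_fin.
  congr (_ * _); rewrite integral_mkcond; apply: eq_integral => x _.
  by rewrite patchE indicE; case: ifP; rewrite ?mul1e ?mul0e.
rewrite -monotone_convergence//=.
- apply: eq_integral => x _; apply/esym/cvg_lim => //=.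
  apply: cvgeMr => //; exact: cvg_nnsfun_approx.
- move=> n; apply: emeasurable_funM; exact/measurable_EFinP.
- by move=> n x _; rewrite mule_ge0 ?lee_fin.
- move=> x _ m n mn; rewrite lee_wpmul2r ?lee_fin//.
  exact/lefP/nd_nnsfun_approx.
Qed.

End integral_density.

Section independent_pair.
Context d d1 d2 (Omega : measurableType d) (T1 : measurableType d1)
  (T2 : measurableType d2) (R : realType) (P : probability Omega R).
Variables (U : Omega -> T1) (V : Omega -> T2).
Hypotheses (mU : measurable_fun setT U) (mV : measurable_fun setT V).
Local Open Scope ereal_scope.

Definition independent_pair := forall A B, measurable A -> measurable B ->
  P (U @^-1` A `&` V @^-1` B) = P (U @^-1` A) * P (V @^-1` B).

(** Independence makes the law of the pair the product of the two laws; Tonelli's theorem gives an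
    iterated integral, pulled back to two copies of [Omega]. *)
Lemma ge0_integral_independent_pair (F : T1 * T2 -> \bar R) :
  independent_pair -> measurable_fun setT F -> (forall x, 0 <= F x) ->
  \int[P]_w F (U w, V w) = \int[P]_w \int[P]_w' F (U w, V w').
Proof.
move=> UV mF F0.
have mUV : measurable_fun setT (fun w => (U w, V w)) by exact: measurable_fun_pair.
pose U' : {RV P >-> T1} := HB.pack U (isMeasurableFun.Build _ _ _ _ _ mU).
pose V' : {RV P >-> T2} := HB.pack V (isMeasurableFun.Build _ _ _ _ _ mV).
pose UV' : {RV P >-> (T1 * T2)%type} :=
  HB.pack (fun w => (U w, V w)) (isMeasurableFun.Build _ _ _ _ _ mUV).
rewrite -(ge0_integral_distribution UV')//.
transitivity (\int[distribution P U' \x distribution P V']_z F z).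
  apply: eq_measure_integral => A mA _; apply/esym.
  by apply: product_measure_unique => // B C mB mC; exact: UV.
rewrite fubini_tonelli1// ge0_integral_distribution//.
- apply: eq_integral => w _ /=.
  rewrite /fubini_F ge0_integral_distribution//.
  exact: measurableT_comp.
- exact: measurable_fun_fubini_tonelli_F.
- by move=> x; exact: integral_ge0.
Qed.

End independent_pair.

(** * Independent families of scalar variables *)

Section scalar_families.
Context d (Omega : measurableType d) (R : realType) (P : probability Omega R).
Context (J : finType) (X : J -> Omega -> R).
Hypothesis mX : forall j, measurable_fun setT (X j).

(** The selection [t] may repeat an index: in the model every view contains the same shared
    sources. *)
Definition cv_of n (t : 'I_n -> J) (w : Omega) : 'cV[R]_n := \col_i X (t i) w.

Lemma measurable_cv_of n (t : 'I_n -> J) : measurable_fun setT (cv_of t).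
Proof.
apply/measurable_fun_matrixP => i j.
by apply: eq_measurable_fun (mX (t i)) => w _; rewrite mxE.
Qed.

Lemma measurable_cv_of_preimage n (t : 'I_n -> J) A : measurable A ->
  measurable (cv_of t @^-1` A).
Proof.
by move=> mA; rewrite -[X in measurable X]setTI; exact: measurable_cv_of.
Qed.

(** All constraints that a box puts on the variable [X j], collected into one set, since [t] may
    reach [j] several times; if it never does, this is the whole line. *)
Let sides n (t : 'I_n -> J) (A : 'I_n -> set R) j := \bigcap_(i in [set i | t i = j]) A i.

Let cv_of_preimage_box n (t : 'I_n -> J) (A : 'I_n -> set R) :
  cv_of t @^-1` box A =
  \bigcap_(j in [set` [set t i | i : 'I_n]%SET]) X j @^-1` sides t A j.
Proof.
apply/seteqP; split=> w /=.
  by move=> Aw j _ i /= tij; have := Aw i; rewrite mxE tij.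
move=> Aw i; rewrite mxE; apply: (Aw (t i)) => //=.
by rewrite imset_f.
Qed.

Hypothesis indX : mutually_independent P X.

(** The index sets are disjoint, so the joint event is a single intersection over their union, and
    mutual independence splits the resulting product. *)
Let cv_of_indep_box p q (t : 'I_p -> J) (u : 'I_q -> J)
    (A : 'I_p -> set R) (B : 'I_q -> set R) :
  (forall i j, t i != u j) ->
  (forall i, measurable (A i)) -> (forall i, measurable (B i)) ->
  P (cv_of t @^-1` box A `&` cv_of u @^-1` box B) =
  (P (cv_of t @^-1` box A) * P (cv_of u @^-1` box B))%E.
Proof.
move=> tu mA mB; rewrite !cv_of_preimage_box.
set K := [set t i | i : 'I_p]%SET; set L := [set u i | i : 'I_q]%SET.
have msides n (v : 'I_n -> J) (C : 'I_n -> set R) j :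
    (forall i, measurable (C i)) -> measurable (sides v C j).
  move=> mC; apply: fin_bigcap_measurable => // i _; exact: mC.
have KL j : j \in K -> j \in L -> False.
  by move=> /imsetP[i _ ->] /imsetP[k _] /eqP; rewrite (negbTE (tu _ _)).
pose C j := if j \in K then sides t A j else sides u B j.
have mC j : measurable (C j) by rewrite /C; case: ifP => _; exact: msides.
have CK j : j \in K -> C j = sides t A j by rewrite /C => ->.
have CL j : j \in L -> C j = sides u B j.
  by rewrite /C => jL; case: ifPn => // /KL /(_ jL).
transitivity (P (\bigcap_(j in [set` (K :|: L)%SET]) X j @^-1` C j)).
  congr (P _); apply/seteqP; split=> w /=.
    move=> [hK hL] j /=; rewrite finset.in_setU => /orP[jK|jL].
      by rewrite /= CK//; exact: hK.
    by rewrite /= CL//; exact: hL.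
  move=> h; split=> j jKL.
    by rewrite -CK//; apply: h; rewrite /= finset.in_setU jKL.
  by rewrite -CL//; apply: h; rewrite /= finset.in_setU jKL orbT.
rewrite !indX//; [|by move=> j; exact: msides..].
rewrite (eq_bigl [predU K & L])/=; last by move=> j; rewrite finset.in_setU.
rewrite bigU/=.
  congr (_ * _)%E; apply: eq_bigr => j jKL; first by rewrite CK.
  by rewrite CL.
by apply/pred0P => j /=; apply/negbTE/negP => /andP[/KL h /h].
Qed.

(** With the event [D] fixed, both sides are finite measures in [A], so agreement on boxes
    suffices. *)
Let indep_of_boxes n (t : 'I_n -> J) (D : set Omega) (A : set 'cV[R]_n) :
  measurable D ->
  (forall B, (forall i, measurable (B i)) ->
    P (cv_of t @^-1` box B `&` D) = (P (cv_of t @^-1` box B) * P D)%E) ->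
  measurable A -> P (cv_of t @^-1` A `&` D) = (P (cv_of t @^-1` A) * P D)%E.
Proof.
move=> mD hbox mA.
have fD : (0 <= fine (P D))%R by rewrite fine_ge0.
have PD : P D = (fine (P D))%:E by rewrite fineK// fin_num_measure.
have mt := measurable_cv_of t.
pose mu1 : {measure set 'cV[R]_n -> \bar R} :=
  pushforward (mrestr P mD) (cv_of t).
pose mu2 : {measure set 'cV[R]_n -> \bar R} :=
  mscale (NngNum fD) (pushforward P (cv_of t)).
have mu2E B : mu2 mt B = (P (cv_of t @^-1` B) * P D)%E.
  by rewrite PD muleC.
rewrite -mu2E; apply: (box_measure_unique (mu := mu1 mt) (nu := mu2 mt)) => //.
  by move=> B mB; rewrite mu2E; exact: hbox.
move=> k; apply: (@le_lt_trans _ _ 1%E); last exact: ltry.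
apply: probability_le1; apply: measurableI => //.
by apply: measurable_cv_of_preimage; exact: measurable_box.
Qed.

(** The passage from boxes to measurable sets is made first in [A] with [B] fixed, then in [B] with
    [A] restricted to a box. *)
Lemma cv_of_independent_pair p q (t : 'I_p -> J) (u : 'I_q -> J) :
  (forall i j, t i != u j) -> independent_pair P (cv_of t) (cv_of u).
Proof.
move=> tu A B mA mB.
apply: indep_of_boxes => //; first exact: measurable_cv_of_preimage.
move=> A' mA'; rewrite setIC muleC.
apply: indep_of_boxes => //.
  by apply: measurable_cv_of_preimage; exact: measurable_box.
move=> B' mB'; rewrite setIC muleC.
by rewrite cv_of_indep_box.
Qed.

(** Induction on the list: head and tail form an independent pair of vectors, of dimensions 1 and
    [size s], so the head factor comes out of the expectation. *)
Lemma ge0_expectation_prod (s : seq J) (f : J -> R -> R) : uniq s ->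
  (forall j, measurable_fun setT (f j)) -> (forall j x, 0 <= f j x) ->
  (\int[P]_w (\prod_(j <- s) f j (X j w))%:E =
   \prod_(j <- s) \int[P]_w (f j (X j w))%:E)%E.
Proof.
move=> + mf f0; elim: s => [_|j s IHs /= /andP[js us]].
  rewrite big_nil; under eq_integral do rewrite big_nil.
  by rewrite integral_cst//= probability_setT mule1.
rewrite big_cons -IHs//.
pose t (i : 'I_(size s)) := tnth (in_tuple s) i.
pose u (i : 'I_1) := j.
pose F (z : 'cV[R]_1 * 'cV[R]_(size s)) :=
  (f j (z.1 0 0) * \prod_(i < size s) f (t i) (z.2 i 0))%:E.
have mF1 : measurable_fun setT (fun z : 'cV[R]_1 * 'cV[R]_(size s) => f j (z.1 0 0)).
  apply: measurableT_comp => //.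
  exact: (measurableT_comp (@measurable_entry _ _ _ _ 0 0) measurable_fst).
have mF2 : measurable_fun setT (fun z : 'cV[R]_1 * 'cV[R]_(size s) =>
    \prod_(i < size s) f (t i) (z.2 i 0)).
  apply: measurable_prod => i _; apply: measurableT_comp => //.
  exact: (measurableT_comp (@measurable_entry _ _ _ _ i 0) measurable_snd).
have mF : measurable_fun setT F.
  by apply/measurable_EFinP; exact: measurable_funM.
have F0 z : (0 <= F z)%E by rewrite lee_fin mulr_ge0// prodr_ge0.
have tu i k : u i != t k.
  by apply: contraNneq js; rewrite /u => ->; exact: mem_tnth.
have FE w w' : F (cv_of u w, cv_of t w') =
    ((f j (X j w))%:E * (\prod_(i <- s) f i (X i w'))%:E)%E.
  rewrite /F /= mxE -EFinM [in RHS]big_tnth; congr (_ * _)%:E.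
  by apply: eq_bigr => i _; rewrite mxE.
transitivity (\int[P]_w F (cv_of u w, cv_of t w))%E.
  by apply: eq_integral => w _; rewrite FE big_cons EFinM.
rewrite ge0_integral_independent_pair//; last exact: cv_of_independent_pair.
- under eq_integral => w _.
    under eq_integral do rewrite FE.
    rewrite ge0_integralZl//.
    + over.
    + apply/measurable_EFinP; apply: measurable_prod => i _.
      exact: measurableT_comp.
    + by move=> w' _; rewrite lee_fin prodr_ge0.
    + by rewrite lee_fin.
  rewrite ge0_integralZr//.
  + by apply/measurable_EFinP; exact: measurableT_comp.
  + by move=> w _; rewrite lee_fin.
  + by apply: integral_ge0 => w _; rewrite lee_fin prodr_ge0.
- exact: measurable_cv_of.
- exact: measurable_cv_of.
Qed.

End scalar_families.

(** * Density of a vector with additive Gaussian noise *)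

(** Tonelli's theorem along the recursive construction of [lebesgue_cv], one coordinate at a
    time. *)
Lemma ge0_integral_lebesgue_cv_prod {R : realType} n (f : 'I_n -> R -> R) :
  (forall i, measurable_fun setT (f i)) -> (forall i x, 0 <= f i x) ->
  (\int[lebesgue_cv n]_z (\prod_i f i (z i 0%R))%:E =
   \prod_i \int[lebesgue_measure]_x (f i x)%:E)%E.
Proof.
elim: n f => [|n IHn] f mf f0.
  rewrite big_ord0 /= integral_dirac//; last first.
    by under eq_fun do rewrite big_ord0; exact: measurable_cst.
  by rewrite diracT mul1e big_ord0.
have mF (k : nat) (g : 'I_k -> R -> R) : (forall i, measurable_fun setT (g i)) ->
    measurable_fun setT (fun z : 'cV[R]_k => (\prod_i g i (z i 0%R))%:E).
  move=> mg; apply/measurable_EFinP; apply: measurable_prod => i _.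
  by apply: measurableT_comp => //; exact: measurable_entry.
have mcons := @measurable_cons_cv R n.
transitivity (\int[pushforward (lebesgue_measure \x lebesgue_cv n)%E
    (@cons_cv R n)]_z (\prod_i f i (z i 0%R))%:E)%E.
  by [].
rewrite ge0_integral_pushforward//; last 2 first.
- exact: mF.
- by move=> z _; rewrite lee_fin prodr_ge0.
rewrite preimage_setT fubini_tonelli1//; last 2 first.
- exact: (measurableT_comp (mF _ f mf) mcons).
- by move=> z; rewrite lee_fin prodr_ge0. 
rewrite big_ord_recl -IHn//.
rewrite -ge0_integralZr//; last 3 first.
- by apply/measurable_EFinP; exact: (mf ord0).
- by move=> x _; rewrite lee_fin.
- by apply: integral_ge0 => v _; rewrite lee_fin prodr_ge0.
apply: eq_integral => x _; rewrite /fubini_F -ge0_integralZl//.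
- apply: eq_integral => v _ /=; rewrite big_ord_recl cons_cv0 EFinM.
  by congr (_ * _%:E)%E; apply: eq_bigr => i _; rewrite cons_cvS.
- by apply: (mF _ (fun i => f (lift ord0 i))) => i; exact: mf.
- by move=> v _; rewrite lee_fin prodr_ge0.
- by rewrite lee_fin.
Qed.

Lemma ge0_integral_box_prod {R : realType} n (f : 'I_n -> R -> R) (A : 'I_n -> set R) :
  (forall i, measurable (A i)) ->
  (forall i, measurable_fun setT (f i)) -> (forall i x, 0 <= f i x) ->
  (\int[lebesgue_cv n]_(z in box A) (\prod_i f i (z i 0%R))%:E =
   \prod_i \int[lebesgue_measure]_(x in A i) (f i x)%:E)%E.
Proof.
move=> mA mf f0.
transitivity (\prod_i \int[lebesgue_measure]_x (f i x * \1_(A i) x)%:E)%E.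
  rewrite -ge0_integral_lebesgue_cv_prod.
  - rewrite integral_mkcond; apply: eq_integral => z _; rewrite patchE.
    rewrite big_split/=; case: ifPn => [/set_mem Az|/negP nAz].
      by rewrite [X in _ * X]big1 ?mulr1// => i _; rewrite indicE mem_set.
    have [i nAi] : exists i, ~ A i (z i 0).
      by apply/existsNP => Az; apply: nAz; rewrite inE.
    by rewrite [X in _ * X](bigD1 i)//= indicE memNset// mul0r mulr0.
  - by move=> i; apply: measurable_funM => //; exact: measurable_indic.
  - by move=> i x; rewrite mulr_ge0.
apply: eq_bigr => i _; rewrite [RHS]integral_mkcond; apply: eq_integral => x _.
by rewrite patchE indicE; case: ifP; rewrite ?mulr1 ?mulr0.
Qed.

Section normal_shift.
Context {R : realType} (sigma : R) (sigma_gt0 : 0 < sigma).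

Let sigma_neq0 : sigma != 0. Proof. by rewrite gt_eqF. Qed.

Lemma normal_pdf_shift (a x : R) : normal_pdf a sigma x = normal_pdf 0 sigma (x - a).
Proof. by rewrite !normal_pdfE// /normal_fun subr0. Qed.

(** Used to integrate out the noise while the source is frozen at [a]. *)
Lemma normal_prob_shift (a : R) (A : set R) : measurable A ->
  normal_prob 0 sigma [set y | A (a + y)] =
  (\int[lebesgue_measure]_(x in A) (normal_pdf a sigma x)%:E)%E.
Proof.
move=> mA.
have ma : @measurable_fun _ _ (measurableTypeR R) (measurableTypeR R) setT
  (fun x => a + x) by apply: measurable_funD => //; exact: measurable_cst.
have mf : measurable_fun (setT : set (measurableTypeR R))
    (fun x => (normal_pdf a sigma x)%:E).
  by apply/measurable_EFinP; exact: measurable_normal_pdf.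
have := ge0_integral_image (mu := lebesgue_measure) (nu := lebesgue_measure)
  (k := NngNum (@ler01 R)) (D := A) ma _ mA mf.
rewrite mul1e => <-.
- by apply: eq_integral => x _; rewrite [in RHS]normal_pdf_shift [a + x]addrC addrK.
- by move=> B mB; rewrite mul1e [RHS](_ : _ = lebesgue_measure [set x | B (a + x)])//
    lebesgue_measure_shift.
- by move=> x; rewrite lee_fin normal_pdf_ge0.
Qed.

End normal_shift.

Section gaussian_noise.
Context d (Omega : measurableType d) (R : realType) (P : probability Omega R).
Context (J : finType) (X : J -> Omega -> R).
Hypothesis mX : forall j, measurable_fun setT (X j).
Hypothesis indX : mutually_independent P X.
Context (sigma : R) (sigma_gt0 : 0 < sigma) (n : nat).
Variables (t u : 'I_n -> J).
Hypothesis tu : forall i j, t i != u j.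
Hypothesis u_inj : injective u.
Hypothesis gaussian_u : forall i, is_gaussian P (X (u i)) 0 sigma.

(** A Gaussian mixture: given the sources, the noisy vector has a product Gaussian density centred
    at them, and this is averaged over the sources. *)
Definition noisy_density (z : 'cV[R]_n) : R :=
  fine (\int[P]_w (\prod_i normal_pdf (X (t i) w) sigma (z i 0%R))%:E).

Let sigma_neq0 : sigma != 0. Proof. by rewrite gt_eqF. Qed.

Let joint (z : 'cV[R]_n) w := \prod_i normal_pdf (X (t i) w) sigma (z i 0).

Let joint_ge0 z w : 0 <= joint z w.
Proof. by apply: prodr_ge0 => i _; exact: normal_pdf_ge0. Qed.

Let joint_le z w : joint z w <= normal_peak sigma ^+ n.
Proof.
have -> : normal_peak sigma ^+ n = \prod_(i < n) normal_peak sigma.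
  by rewrite prodr_const card_ord.
apply: ler_prod => i _.
by rewrite normal_pdf_ge0/= normal_pdf_ub.
Qed.

Let measurable_joint : measurable_fun setT
  (fun zw : 'cV[R]_n * Omega => joint zw.1 zw.2).
Proof.
apply: measurable_prod => i _.
rewrite (_ : (fun _ => _) =
  normal_pdf 0 sigma \o (fun zw : 'cV[R]_n * Omega => zw.1 i 0 - X (t i) zw.2)).
  apply: measurableT_comp; first exact: measurable_normal_pdf.
  apply: measurable_funB.
    exact: (measurableT_comp (@measurable_entry _ _ _ _ i 0) measurable_fst).
  exact: (measurableT_comp (mX (t i)) measurable_snd).
by apply/funext => zw /=; rewrite normal_pdf_shift.
Qed.

Let measurable_joint_r z : measurable_fun setT (joint z).
Proof. exact: (measurableT_comp measurable_joint (measurable_pair1 z)). Qed.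

(** The integrand is at most [normal_peak sigma ^+ n], so the expectation is finite and [fine] loses
    nothing. *)
Lemma noisy_densityE z : (noisy_density z)%:E =
  (\int[P]_w (\prod_i normal_pdf (X (t i) w) sigma (z i 0%R))%:E)%E.
Proof.
rewrite /noisy_density fineK// ge0_fin_numE; last first.
  by apply: integral_ge0 => w _; rewrite lee_fin joint_ge0.
apply: (@le_lt_trans _ _ (\int[P]_w (cst (normal_peak sigma ^+ n)%:E w)))%E.
  apply: ge0_le_integral => //.
  - by move=> w _; rewrite lee_fin joint_ge0.
  - exact/measurable_EFinP/measurable_joint_r.
  - by move=> w _; rewrite lee_fin joint_le.
by rewrite integral_cst//= probability_setT mule1 ltry.
Qed.

Lemma noisy_density_ge0 z : 0 <= noisy_density z.
Proof.
by rewrite -lee_fin noisy_densityE integral_ge0// => w _; rewrite lee_fin joint_ge0.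
Qed.

Lemma measurable_noisy_density : measurable_fun setT noisy_density.
Proof.
apply/measurable_EFinP; rewrite (_ : _ \o _ = fun z => \int[P]_w (joint z w)%:E)%E.
  apply: (measurable_fun_fubini_tonelli_F
    (fun zw : 'cV[R]_n * Omega => (joint zw.1 zw.2)%:E)).
  - exact/measurable_EFinP.
  - by move=> zw; rewrite lee_fin joint_ge0.
by apply/funext => z; exact: noisy_densityE.
Qed.

(** Independence of sources and noise allows the noise to be integrated first, with the sources
    frozen; this gives a product of one-dimensional Gaussian probabilities of shifted sides.
    Tonelli's theorem then brings the Lebesgue integral outside. *)
Let noisy_box (A : 'I_n -> set R) : (forall i, measurable (A i)) ->
  P ((fun w => cv_of X t w + cv_of X u w) @^-1` box A) =
  (\int[lebesgue_cv n]_(z in box A) (noisy_density z)%:E)%E.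
Proof.
move=> mA.
have mshift (a : R) i : measurable [set y | A i (a + y)].
  rewrite -[X in measurable X]setTI.
  have : measurable_fun setT (fun x : R => a + x).
    by apply: measurable_funD => //; exact: measurable_cst.
  exact.
pose F (vw : 'cV[R]_n * 'cV[R]_n) : \bar R := (\1_(box A) (vw.1 + vw.2))%:E.
have mF : measurable_fun setT F.
  apply/measurable_EFinP; apply: measurableT_comp.
    by apply: measurable_indic; exact: measurable_box.
  apply/measurable_fun_matrixP => i j; under eq_fun do rewrite mxE.
  apply: measurable_funD.
    exact: (measurableT_comp (@measurable_entry _ _ _ _ i j) measurable_fst).
  exact: (measurableT_comp (@measurable_entry _ _ _ _ i j) measurable_snd).
have mS : measurable ((fun w => cv_of X t w + cv_of X u w) @^-1` box A).
  rewrite -[X in measurable X]setTI.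
  have : measurable_fun setT (fun w => cv_of X t w + cv_of X u w).
    apply/measurable_fun_matrixP => i j; under eq_fun do rewrite !mxE.
    exact: measurable_funD.
  by move=> /(_ measurableT _ (measurable_box mA)).
have F0 vw : (0 <= F vw)%E by rewrite lee_fin.
transitivity (\int[P]_w F (cv_of X t w, cv_of X u w))%E.
  by rewrite -[X in P X = _]setIT -integral_indic.
rewrite ge0_integral_independent_pair//; last 3 first.
- exact: measurable_cv_of.
- exact: measurable_cv_of.
- exact: cv_of_independent_pair.
transitivity (\int[P]_w \int[lebesgue_cv n]_(z in box A) (joint z w)%:E)%E.
  apply: eq_integral => w _.
  rewrite (ge0_integral_box_prod (f := fun i => normal_pdf (X (t i) w) sigma))//; last 2 first.
  - by move=> i; exact: measurable_normal_pdf.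
  - by move=> i x; exact: normal_pdf_ge0.
  pose C i := [set y | A i (X (t i) w + y)].
  have -> : (\int[P]_w' F (cv_of X t w, cv_of X u w') =
      P (cv_of X u @^-1` box C))%E.
    rewrite -[X in _ = P X]setIT -integral_indic//; last first.
      by apply: measurable_cv_of_preimage => //; apply: measurable_box => i; exact: mshift.
    apply: eq_integral => w' _; rewrite /F /= !indicE; congr (nat_of_bool _)%:R%:E.
    by apply/idP/idP => /set_mem h; apply/mem_set => i; have := h i; rewrite /= !mxE.
  (* Mutual independence asks for sides indexed by [J]; as [u] is injective, [CJ (u i)] is just
     [C i]. *)
  pose CJ j := \bigcap_(i in [set i | u i = j]) C i.
  have CJE i : CJ (u i) = C i.
    apply/seteqP; split=> y; first by apply.
    by move=> Cy k /= /u_inj ->.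
  have mC i : measurable (C i) by exact: mshift.
  have mCJ j : measurable (CJ j).
    by apply: fin_bigcap_measurable => // i _; exact: mC.
  have -> : cv_of X u @^-1` box C =
      \bigcap_(j in [set` [set u i | i : 'I_n]%SET]) X j @^-1` CJ j.
    apply/seteqP; split=> w' /=.
      by move=> h j _ i /= uij; have := h i; rewrite mxE uij.
    by move=> h i; rewrite mxE -CJE; apply: (h (u i)); rewrite /= imset_f.
  rewrite indX// big_imset/=; last by move=> i j _ _; exact: u_inj.
  rewrite big_mkcond/=; apply: eq_bigr => i _.
  by rewrite CJE gaussian_u// normal_prob_shift.
pose h (wz : Omega * 'cV[R]_n) : \bar R :=
  ((joint wz.2 wz.1)%:E * (\1_(box A) wz.2)%:E)%E.
have mh : measurable_fun setT h.
  apply: emeasurable_funM.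
    apply/measurable_EFinP.
    exact: (measurableT_comp measurable_joint (@measurable_swap _ _ Omega 'cV[R]_n)).
  apply/measurable_EFinP; apply: (measurableT_comp _ measurable_snd).
  by apply: measurable_indic; exact: measurable_box.
have h0 wz : (0 <= h wz)%E by rewrite mule_ge0// lee_fin// joint_ge0.
transitivity (\int[P]_w \int[lebesgue_cv n]_z h (w, z))%E.
  apply: eq_integral => w _; rewrite integral_mkcond; apply: eq_integral => z _.
  by rewrite patchE /h /= indicE; case: ifP; rewrite ?mule1 ?mule0.
rewrite fubini_tonelli// [RHS]integral_mkcond; apply: eq_integral => z _.
rewrite patchE noisy_densityE /h /= indicE; case: ifP => _ /=.
  by apply: eq_integral => w _; rewrite mule1.
by apply: integral0_eq => w _; rewrite mule0.
Qed.

Lemma noisy_density_is_density :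
  is_density P (fun w => cv_of X t w + cv_of X u w) noisy_density.
Proof.
split; [exact: measurable_noisy_density|exact: noisy_density_ge0|].
have mZ : measurable_fun setT (fun w => cv_of X t w + cv_of X u w).
  apply/measurable_fun_matrixP => i j; under eq_fun do rewrite !mxE.
  exact: measurable_funD.
pose mu : {measure set 'cV[R]_n -> \bar R} :=
  pushforward P (fun w => cv_of X t w + cv_of X u w).
pose nu : {measure set 'cV[R]_n -> \bar R} :=
  density_measure (lebesgue_cv n) measurable_noisy_density noisy_density_ge0.
move=> A mA.
apply: (box_measure_unique (mu := mu mZ) (nu := nu)) => //.
move=> k; apply: (@le_lt_trans _ _ 1%E); last exact: ltry.
apply: probability_le1; rewrite -[X in measurable X]setTI.
by apply: mZ => //; exact: measurable_box.
Qed.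

End gaussian_noise.

(** * Uniqueness and regularity of densities *)

Section positive_density.
Context d (T : measurableType d) (R : realType) (mu : {measure set T -> \bar R}).

(** Later applied to a positive density: a set of values taken with probability 0 is then Lebesgue
    null. *)
Lemma null_set_of_integral_eq0 (q : T -> R) (A : set T) :
  measurable_fun setT q -> (forall x, 0 < q x) -> measurable A ->
  (\int[mu]_(x in A) (q x)%:E = 0)%E -> mu A = 0%E.
Proof.
move=> mq q0 mA intq.
have : ae_eq mu A (EFin \o q) (cst 0%E).
  apply/(ae_eq_integral_abs mu mA); first exact/measurable_EFinP/measurable_funTS.
  by rewrite -[RHS]intq; apply: eq_integral => x _; rewrite /= gtr0_norm.
move=> /= ae0; apply/(negligibleP mu mA); apply: negligibleS ae0 => x Ax /= /(_ Ax)[] qx.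
by have := q0 x; rewrite qx ltxx.
Qed.

End positive_density.

Lemma expectation_gt0 d (Omega : measurableType d) (R : realType)
    (P : probability Omega R) (q : Omega -> R) :
  measurable_fun setT q -> (forall w, 0 < q w) ->
  (0 < \int[P]_w (q w)%:E)%E.
Proof.
move=> mq q0; rewrite lt0e integral_ge0 ?andbT; last first.
  by move=> w _; rewrite lee_fin ltW.
apply/eqP => /(null_set_of_integral_eq0 mq q0 measurableT).
by move=> /eqP; rewrite /= probability_setT onee_eq0.
Qed.

Lemma measurable_neq_fun d (T : measurableType d) (R : realType) (f g : T -> R) :
  measurable_fun setT f -> measurable_fun setT g -> measurable [set x | f x != g x].
Proof.
move=> mf mg.
have -> : [set x | f x != g x] = setT `&` [set x | (f x)%:E != (g x)%:E].
  by rewrite setTI; apply/seteqP; split=> x /=; rewrite eqe.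
by apply: measurable_neqe => //; exact/measurable_EFinP.
Qed.

(** The two functions have the same integral over every measurable set, and total mass 1 makes them
    integrable, so they agree almost everywhere. *)
Lemma is_density_ae_unique (R : realType) d (Omega : measurableType d)
    (P : probability Omega R) n (Y : Omega -> 'cV[R]_n) (p q : 'cV[R]_n -> R) :
  is_density P Y p -> is_density P Y q ->
  lebesgue_cv n [set x | p x != q x] = 0%E.
Proof.
move=> [mp p0 pE] [mq q0 qE].
have mpq := measurable_neq_fun mp mq.
have : ae_eq (lebesgue_cv n) setT (EFin \o p) (EFin \o q).
  apply: integral_ae_eq => //.
  - apply/integrableP; split; first exact/measurable_EFinP.
    under eq_integral do rewrite /= ger0_norm//.
    by rewrite -pE// preimage_setT /= probability_setT ltry.
  - exact/measurable_EFinP.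
  - by move=> B _ mB; rewrite /= -pE// -qE.
move=> ae0; apply/(negligibleP _ mpq); apply: negligibleS ae0 => x /= /eqP pq.
by move=> /(_ Logic.I)[].
Qed.

Lemma lebesgue_cv_ball_gt0 (R : realType) n (x : 'cV[R]_n) (e : R) : 0 < e ->
  (0 < lebesgue_cv n (box (fun i => `](x i 0 - e)%R, (x i 0 + e)%R[%classic)))%E.
Proof.
move=> e0; rewrite lebesgue_cv_box//.
apply: (big_ind (fun y => 0 < y)%E) => [|a b|i _]; [by rewrite lte01|exact: mule_gt0|].
rewrite lebesgue_measure_itv/= lte_fin ltrD2l gtrN//.
by rewrite -EFinB lte_fin opprB addrC subrKA addr_gt0.
Qed.

(** The set where two continuous functions differ is open; if nonempty it contains a cube, which has
    positive measure. *)
Lemma continuous_ae_eq (R : realType) n (f g : 'cV[R]_n -> R) :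
  measurable [set x | f x != g x] ->
  continuous f -> continuous g -> lebesgue_cv n [set x | f x != g x] = 0%E ->
  forall x, f x = g x.
Proof.
move=> mfg cf cg fg0 x; apply/eqP/negPn/negP => fgx.
have : nbhs x [set x | f x != g x].
  have ch : {for x, continuous (fun y => f y - g y)}.
    by apply: continuousB; [exact: cf|exact: cg].
  have : \forall y \near x, f y - g y != 0.
    by apply: (@cvgr_neq0 _ _ _ _ _ (fun y => f y - g y) _ ch); rewrite subr_eq0.
  by apply: filterS => y /=; rewrite subr_eq0.
move=> /nbhs_ballP[e /= e0 sub].
have := lebesgue_cv_ball_gt0 x e0; rewrite ltNge => /negP; apply.
rewrite -fg0; apply: le_measure; rewrite ?inE//.
  exact: measurable_box.
move=> y By; apply: sub; split=> // i j; rewrite (ord1 j) /ball/= distrC ltr_distl.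
by have := By i; rewrite /= in_itv.
Qed.

(** * Lipschitz estimates for Gaussians and Gaussian mixtures *)

Section lipschitz.
Context {R : realType}.

(* A one-sided inequality suffices, since x and y can be exchanged. *)
Definition lipschitz_cv n (f : 'cV[R]_n -> R) :=
  exists2 K, 0 <= K & forall x y, f x <= f y + K * \sum_i `|x i 0 - y i 0|.

Lemma lipschitz_cv_continuous n (f : 'cV[R]_n -> R) : lipschitz_cv f -> continuous f.
Proof.
move=> [K K0 fK] x; have Fx : Filter (nbhs x) := nbhs_filter x.
apply/cvgrPdist_lt => /= e e0.
(* Adding 1 keeps the denominator positive when [K] or [n] is 0 and makes the final bound strict. *)
have d0 : 0 < e / (K * n%:R + 1).
  by rewrite divr_gt0// ltr_wpDl// mulr_ge0.
apply: filterS (nbhsx_ballx x _ d0) => y [_ xy].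
have sxy : K * \sum_i `|x i 0 - y i 0| < e.
  apply: (@le_lt_trans _ _ (K * (n%:R * (e / (K * n%:R + 1))))).
    apply: ler_wpM2l => //.
    have -> : n%:R * (e / (K * n%:R + 1)) = \sum_(i < n) (e / (K * n%:R + 1)).
      by rewrite sumr_const card_ord mulr_natl.
    by apply: ler_sum => i _; apply: ltW; exact: (xy i 0).
  have -> : K * (n%:R * (e / (K * n%:R + 1))) = e * (K * n%:R / (K * n%:R + 1)).
    by ring.
  rewrite gtr_pMr// ltr_pdivrMr ?mul1r ?ltrDl//.
  by rewrite ltr_wpDl// mulr_ge0.
have syx : \sum_i `|y i 0 - x i 0| = \sum_i `|x i 0 - y i 0|.
  by apply: eq_bigr => i _; rewrite distrC.
rewrite ltr_norml; have := fK x y; have := fK y x; rewrite syx; lra.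
Qed.

Lemma lipschitz_cv_mulmx m n (M : 'M[R]_(m, n)) (f : 'cV[R]_m -> R) (k : R) :
  0 <= k -> lipschitz_cv f -> lipschitz_cv (fun x => k * f (M *m x)).
Proof.
move=> k0 [K K0 fK]; exists (k * (K * \sum_i \sum_j `|M i j|)).
  by rewrite !mulr_ge0// sumr_ge0// => i _; rewrite sumr_ge0.
move=> x y; apply: (@le_trans _ _ (k * (f (M *m y) +
    K * \sum_i `|(M *m x) i 0 - (M *m y) i 0|))).
  exact: ler_wpM2l.
rewrite mulrDr lerD2l -!mulrA; apply: ler_wpM2l => //; apply: ler_wpM2l => //.
rewrite mulr_suml; apply: ler_sum => i _.
rewrite !mxE -sumrB; apply: (le_trans (ler_norm_sum _ _ _)).
rewrite mulr_suml; apply: ler_sum => j _.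
rewrite -mulrBr normrM; apply: ler_wpM2l => //.
by rewrite (bigD1 j)//= lerDl sumr_ge0.
Qed.

(** If [|t| <= |s|] the Gaussian is at least as large at [t]. Otherwise [expR x >= 1 + x] bounds the
    drop from [s] to [t] by the Gaussian at [s] times [k * (t ^+ 2 - s ^+ 2)], which is controlled
    when [|t|] and [|s|] are close. *)
Lemma gauss_lipschitz (k s t : R) : 0 < k ->
  expR (- (k * s ^+ 2)) <= expR (- (k * t ^+ 2)) + (2 * k + 1) * `|s - t|.
Proof.
move=> k0.
have gt0 := expR_gt0 (- (k * t ^+ 2)); have gs0 := expR_gt0 (- (k * s ^+ 2)).
have st0 := normr_ge0 (s - t).
have [ts|st] := leP `|t| `|s|.
  apply: (@le_trans _ _ (expR (- (k * t ^+ 2)))); last first.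
    by rewrite lerDl mulr_ge0//; nra.
  rewrite ler_expR lerN2 ler_pM2l// -(real_normK (num_real t)).
  by rewrite -(real_normK (num_real s)) ler_sqr ?nnegrE.
have gs1 : expR (- (k * s ^+ 2)) <= 1.
  by rewrite expR_le1 oppr_le0 mulr_ge0 ?sqr_ge0 ?ltW.
have dst : `|t| - `|s| <= `|s - t| by rewrite distrC; exact: lerB_dist.
(* At distance at least 1 the bound holds because the Gaussian is at most 1 and the constant at
   least 1. *)
have [far|near] := leP 1 (`|t| - `|s|).
  by nra.
have gsk : expR (- (k * s ^+ 2)) * (1 + k * s ^+ 2) <= 1.
  rewrite -[leRHS](expR0 R) -(addNr (k * s ^+ 2)) expRD ler_pM2l//.
  exact: expR_ge1Dx.
have gtE : expR (- (k * s ^+ 2)) * (1 - k * (t ^+ 2 - s ^+ 2)) <= expR (- (k * t ^+ 2)).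
  have -> : - (k * t ^+ 2) = - (k * s ^+ 2) + - (k * (t ^+ 2 - s ^+ 2)) by ring.
  rewrite expRD ler_pM2l//; exact: expR_ge1Dx.
have t2 : t ^+ 2 = `|t| ^+ 2 by rewrite real_normK ?num_real.
have s2 : s ^+ 2 = `|s| ^+ 2 by rewrite real_normK ?num_real.
rewrite {}t2 {}s2 in gs0 gs1 gt0 gsk gtE *.
move: (expR (- (k * `|s| ^+ 2))) (expR (- (k * `|t| ^+ 2))) gs0 gs1 gt0 gsk gtE.
move=> g h gs0 gs1 gt0 gsk gtE.
have s0 := normr_ge0 s; have t0 := normr_ge0 t.
move: (`|s|) (`|t|) s0 t0 st dst near gsk gtE => a b a0 b0 ab dst near gsk gtE.
(* The sum [b + a] is at most [2 * a + 1]; its growth in [a] is absorbed by the Gaussian, through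
   [2 * a <= 1 + a ^+ 2] and [g * (1 + k * a ^+ 2) <= 1]. *)
have h1 : g * (k * (2 * a + 1)) <= 2 * k + 1.
  have gk : g * k <= k by rewrite ler_piMl// ltW.
  have a2 : 2 * a <= 1 + a ^+ 2.
    by have := sqr_ge0 (a - 1); rewrite sqrrB1; lra.
  have gka : (g * k) * (2 * a) <= (g * k) * (1 + a ^+ 2).
    by apply: ler_wpM2l => //; rewrite mulr_ge0 ?ltW.
  nra.
have h2 : g * (k * (b ^+ 2 - a ^+ 2)) <= (2 * k + 1) * (b - a).
  have -> : g * (k * (b ^+ 2 - a ^+ 2)) = (g * (k * (b + a))) * (b - a) by ring.
  apply: ler_wpM2r; first by lra.
  apply: le_trans h1; apply: ler_wpM2l; first exact: ltW.
  by apply: ler_wpM2l; [exact: ltW|lra].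
have h3 : (2 * k + 1) * (b - a) <= (2 * k + 1) * `|s - t| by apply: ler_wpM2l => //; lra.
nra.
Qed.

(** The factors are exchanged one at a time: as all of them lie in [0, 1], each exchange costs at
    most its own [e i]. *)
Lemma prod_unit_lipschitz (I : Type) (r : seq I) (a b e : I -> R) :
  (forall i, 0 <= a i <= 1) -> (forall i, 0 <= b i <= 1) ->
  (forall i, 0 <= e i) -> (forall i, a i <= b i + e i) ->
  \prod_(i <- r) a i <= \prod_(i <- r) b i + \sum_(i <- r) e i.
Proof.
move=> a01 b01 e0 abe; elim: r => [|i r IHr]; first by rewrite !big_nil addr0.
rewrite !big_cons.
have : 0 <= \prod_(j <- r) a j <= 1.
  rewrite prodr_ge0/=; last by move=> j _; case/andP: (a01 j).
  by apply: prodr_ile1 => j.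
have : 0 <= \prod_(j <- r) b j <= 1.
  rewrite prodr_ge0/=; last by move=> j _; case/andP: (b01 j).
  by apply: prodr_ile1 => j.
have : 0 <= \sum_(j <- r) e j by apply: sumr_ge0.
move: (a01 i) (b01 i) (abe i) (e0 i) IHr.
move: (a i) (b i) (e i) (\prod_(j <- r) a j) (\prod_(j <- r) b j) (\sum_(j <- r) e j).
move=> x y z p q s /andP[x0 x1] /andP[y0 y1] xyz z0 pqs s0 /andP[q0 q1] /andP[p0 p1].
have : x * p <= (y + z) * p by apply: ler_wpM2r.
have : y * p <= y * (q + s) by apply: ler_wpM2l.
have : z * p <= z by rewrite ler_piMr.
have : y * s <= s by rewrite ler_piMl.
nra.
Qed.

End lipschitz.

Section noisy_density_regularity.
Context d (Omega : measurableType d) (R : realType) (P : probability Omega R).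
Context (J : finType) (X : J -> Omega -> R).
Hypothesis mX : forall j, measurable_fun setT (X j).
Context (sigma : R) (sigma_gt0 : 0 < sigma) (n : nat) (t : 'I_n -> J).

Let sigma_neq0 : sigma != 0. Proof. by rewrite gt_eqF. Qed.

Lemma normal_pdf_gt0 (a x : R) : 0 < normal_pdf a sigma x.
Proof. by rewrite normal_pdfE// mulr_gt0 ?normal_peak_gt0// expR_gt0. Qed.

Lemma measurable_normal_pdf_mean (x : R) :
  measurable_fun setT (fun a => normal_pdf a sigma x).
Proof.
rewrite (_ : (fun _ => _) = normal_pdf 0 sigma \o (fun a => x - a)).
  apply: measurableT_comp; first exact: measurable_normal_pdf.
  by apply: measurable_funB => //; exact: measurable_cst.
by apply/funext => a /=; rewrite normal_pdf_shift.
Qed.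

Lemma measurable_prod_normal_pdf (I : finType) (h : I -> J) (z : I -> R) :
  measurable_fun setT (fun w => \prod_i normal_pdf (X (h i) w) sigma (z i)).
Proof.
apply: measurable_prod => i _.
exact: (measurableT_comp (measurable_normal_pdf_mean (z i)) (mX (h i))).
Qed.

Lemma noisy_density_gt0 (z : 'cV[R]_n) : 0 < noisy_density P X sigma t z.
Proof.
rewrite -lte_fin noisy_densityE//; apply: expectation_gt0.
  exact: measurable_prod_normal_pdf.
by move=> w; apply: prodr_gt0 => i _; exact: normal_pdf_gt0.
Qed.

Lemma prod_normal_pdfE (I : finType) (a z : I -> R) :
  \prod_i normal_pdf (a i) sigma (z i) =
  normal_peak sigma ^+ #|I| *
  \prod_i expR (- ((2 * sigma ^+ 2)^-1 * (z i - a i) ^+ 2)).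
Proof.
rewrite -prodr_const -big_split/=; apply: eq_bigr => i _.
rewrite normal_pdfE//; congr (_ * expR _).
by rewrite mulNr mulrC -mulr_natl.
Qed.

(** For each outcome the integrand is Lipschitz in [z] with a constant independent of the outcome,
    so the bound passes to the expectation. *)
Lemma lipschitz_noisy_density : lipschitz_cv (noisy_density P X sigma t).
Proof.
pose k := (2 * sigma ^+ 2)^-1.
have k0 : 0 < k by rewrite invr_gt0 mulr_gt0// exprn_gt0.
(* One [normal_peak] per coordinate, times the constant of [gauss_lipschitz]. *)
pose K := normal_peak sigma ^+ n * (2 * k + 1).
have pk0 : 0 <= normal_peak sigma ^+ n by rewrite exprn_ge0 ?normal_peak_ge0.
have k1 : 0 <= 2 * k + 1 by lra.
exists K; first by rewrite mulr_ge0.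
move=> x y; rewrite -lee_fin EFinD !noisy_densityE//.
set e := K * _.
have e0 : 0 <= e by rewrite !mulr_ge0// sumr_ge0.
have pdf0 z w : 0 <= \prod_i normal_pdf (X (t i) w) sigma (z i 0 : R).
  by apply: prodr_ge0 => i _; exact: normal_pdf_ge0.
have -> : e%:E = (\int[P]_w (cst e%:E w))%E.
  by rewrite integral_cst//= probability_setT mule1.
rewrite -ge0_integralD//; last 2 first.
- by move=> w _; rewrite lee_fin pdf0.
- by apply/measurable_EFinP; exact: measurable_prod_normal_pdf.
apply: ge0_le_integral => //.
- by move=> w _; rewrite lee_fin pdf0.
- by apply/measurable_EFinP; exact: measurable_prod_normal_pdf.
- apply: emeasurable_funD => //.
  by apply/measurable_EFinP; exact: measurable_prod_normal_pdf.
move=> w _; rewrite -EFinD lee_fin !prod_normal_pdfE card_ord /e /K -mulrA -mulrDr.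
apply: ler_wpM2l => //; rewrite mulr_sumr.
apply: prod_unit_lipschitz => i.
- by rewrite expR_ge0 expR_le1 oppr_le0 mulr_ge0 ?sqr_ge0// ltW.
- by rewrite expR_ge0 expR_le1 oppr_le0 mulr_ge0 ?sqr_ge0// ltW.
- by rewrite mulr_ge0.
apply: le_trans (gauss_lipschitz _ (y i 0 - X (t i) w) k0) _.
by rewrite opprB addrA subrK.
Qed.

End noisy_density_regularity.

(** * Subfamilies of variables, densities under linear maps, block-diagonal determinants *)

Lemma mutually_independent_inj d (Omega : measurableType d) (R : realType)
    (P : probability Omega R) (I J : finType) (X : J -> Omega -> R) (h : I -> J) :
  injective h -> mutually_independent P X ->
  mutually_independent P (fun i => X (h i)).
Proof.
move=> h_inj indX K B mB.
pose C j := \bigcap_(i in [set i | h i = j]) B i.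
have CE i : C (h i) = B i.
  apply/seteqP; split=> y; first by apply.
  by move=> By k /= /h_inj ->.
have mC j : measurable (C j) by apply: fin_bigcap_measurable => // i _; exact: mB.
have := indX [set h i | i in K]%SET C mC.
rewrite big_imset/=; last by move=> i j _ _; exact: h_inj.
under eq_bigr do rewrite CE.
move=> <-; congr (P _); apply/seteqP; split=> w /= hw.
  by move=> _ /imsetP[i iK ->]; rewrite CE; exact: hw.
by move=> i iK; rewrite -CE; apply: (hw (h i)); rewrite /= imset_f.
Qed.

Lemma ge0_expectation_prod_inj d (Omega : measurableType d) (R : realType)
    (P : probability Omega R) (I J : finType) (X : J -> Omega -> R) (h : I -> J)
    (f : I -> R -> R) :
  (forall j, measurable_fun setT (X j)) -> mutually_independent P X ->
  injective h -> (forall i, measurable_fun setT (f i)) -> (forall i x, 0 <= f i x) ->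
  (\int[P]_w (\prod_i f i (X (h i) w))%:E = \prod_i \int[P]_w (f i (X (h i) w))%:E)%E.
Proof.
move=> mX indX h_inj mf f0.
apply: (@ge0_expectation_prod _ _ _ P I (fun i => X (h i))) => //.
  exact: mutually_independent_inj.
exact: index_enum_uniq.
Qed.

(** The substitution [y = W x] in the integral of [p]; with [W] block diagonal it yields the density
    of the observation. *)
Lemma is_density_invmx (R : realType) d (Omega : measurableType d)
    (P : probability Omega R) n (Y : Omega -> 'cV[R]_n) (p : 'cV[R]_n -> R)
    (W : 'M[R]_n) : W \in unitmx -> is_density P Y p ->
  is_density P (fun w => invmx W *m Y w) (fun x => `|\det W| * p (W *m x)).
Proof.
move=> Wu [mp p0 pE].
have mpW : measurable_fun setT (fun x : 'cV[R]_n => p (W *m x)).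
  exact: (measurableT_comp mp (measurable_mulmx W)).
split.
- by apply: measurable_funM => //; exact: measurable_cst.
- by move=> x; rewrite mulr_ge0.
move=> A mA.
have mA' : measurable [set y | A (invmx W *m y)].
  by rewrite -[X in measurable X]setTI; exact: measurable_mulmx.
rewrite -[LHS]/(P (Y @^-1` [set y | A (invmx W *m y)])) pE//.
rewrite -(ge0_integral_mulmx (f := fun y => (p y)%:E) Wu mA')//; last first.
- exact/measurable_EFinP.
rewrite (_ : [set v | _] = A); last first.
  by apply/seteqP; split=> v /=; rewrite mulKmx.
under [RHS]eq_integral do rewrite EFinM.
rewrite ge0_integralZl//; last 2 first.
- exact/measurable_EFinP/measurable_funTS.
- by move=> x _; rewrite lee_fin.
Qed.

Lemma det_mxdiag (R : comNzRingType) D (k : 'I_D -> nat) (W : forall d, 'M[R]_(k d)) :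
  \det (\mxdiag_d W d) = \prod_d \det (W d).
Proof.
elim: D k W => [|D IHD] k W.
  (* A sum of sizes over ['I_0] is 0 only propositionally, hence the statement for any [n] equal to
     0. *)
  have det0 n (M : 'M[R]_n) : n = 0%N -> \det M = 1.
    by move=> n0; move: M; rewrite n0 => M; rewrite det_mx00.
  by rewrite [RHS]big_ord0 det0 ?big_ord0.
rewrite [RHS]big_ord_recl mxdiag_recl -IHD -(det_lblock _ 0).
by case: _ / mxsize_recl.
Qed.

Lemma unitmx_mxdiag (R : comUnitRingType) D (k : 'I_D -> nat)
    (W : forall d, 'M[R]_(k d)) :
  (forall d, W d \in unitmx) -> \mxdiag_d W d \in unitmx.
Proof.
by move=> Wu; rewrite unitmxE det_mxdiag; apply: rpred_prod => d _; rewrite -unitmxE.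
Qed.

Lemma ln_prod (R : realType) (I : Type) (r : seq I) (f : I -> R) :
  (forall i, 0 < f i) -> ln (\prod_(i <- r) f i) = \sum_(i <- r) ln (f i).
Proof.
move=> f0; elim: r => [|i r IHr]; first by rewrite !big_nil ln1.
by rewrite !big_cons lnM ?posrE ?prodr_gt0// IHr.
Qed.

(** * The multi-view model *)

Section complete_square.
Context {R : realType} {D c : nat} (D_gt0 : (0 < D)%N).
Context (sigma : R) (z : 'I_D -> 'cV[R]_c).

Definition dot (u v : 'cV[R]_c) := \sum_a u a 0 * v a 0.

(** The sum of the squared distances of the [z d] from their mean, in the form that matches the
    traces. *)
Definition scatter := \sum_d (dot (z d) (z d) - 1 / D%:R * \sum_l dot (z d) (z l)).

(** Once the sum over coordinates is pulled outside, both sides are, in each coordinate, the same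
    quadratic expression in [v] and the first two power sums of the [z d]. *)
Lemma sum_sqr_dist (v : 'cV[R]_c) :
  \sum_a \sum_d (z d a 0 - v a 0) ^+ 2 =
  scatter + D%:R * enorm (v - D%:R^-1 *: \sum_d z d) ^+ 2.
Proof.
rewrite /enorm sqr_sqrtr; last by apply: sumr_ge0 => a _; exact: sqr_ge0.
have D0 : D%:R != 0 :> R by rewrite pnatr_eq0 -lt0n.
rewrite /scatter /dot sumrB -mulr_sumr.
under [X in _ - _ * X]eq_bigr do rewrite exchange_big/=.
rewrite [in X in _ - _ * X]exchange_big/= [in X in X - _]exchange_big/=.
rewrite !mulr_sumr -sumrB -big_split/=; apply: eq_bigr => a _.
rewrite !mxE summxE.
have -> : \sum_d (z d a 0 - v a 0) ^+ 2 =
    \sum_d z d a 0 * z d a 0 - 2 * v a 0 * \sum_d z d a 0 + D%:R * v a 0 ^+ 2.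
  have -> : D%:R * v a 0 ^+ 2 = \sum_(d < D) v a 0 ^+ 2.
    by rewrite sumr_const card_ord mulr_natl.
  by rewrite mulr_sumr -sumrB -big_split/=; apply: eq_bigr => d _; ring.
have -> : \sum_d \sum_l z d a 0 * z l a 0 = (\sum_d z d a 0) * (\sum_d z d a 0).
  by rewrite mulr_suml; apply: eq_bigr => d _; rewrite mulr_sumr.
by field.
Qed.

End complete_square.

Section model_density.
Context {R : realType} {D c : nat} {m : 'I_D -> nat} {sigma : R}.
Hypotheses (D_gt0 : (0 < D)%N) (sigma_gt0 : 0 < sigma).
Context {dO : measure_display} {Omega : measurableType dO} {P : probability Omega R}.
Context {s0 : {RV P >-> 'cV[R]_c}} {s : forall d, {RV P >-> 'cV[R]_(m d)}}.
Context {eps : forall d, {RV P >-> 'cV[R]_(c + m d)}}.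
Hypothesis model : multiview_model s0 s eps sigma.

Local Notation n := (\sum_d (c + m d))%N.
Local Notation source := ('I_c + {d : 'I_D & 'I_(m d)})%type.
Local Notation noise := {d : 'I_D & 'I_(c + m d)}.
Local Notation X := (scalar_component s0 s eps).

Let measurable_X j : measurable_fun setT (X j).
Proof.
by case: j => [[a|da]|da] /=; apply: (measurableT_comp (@measurable_entry _ _ _ _ _ _));
  exact: measurable_funP.
Qed.

Let indX : mutually_independent P X. Proof. by case: model. Qed.

(** The source to which a noise component is added; the first [c] components of every view lead to
    the same shared sources. *)
Definition source_of (i : noise) : source :=
  match fintype.split (tagged i) with inl a => inl a | inr b => inr (Tagged _ b) end.

Definition joint_source (i : 'I_n) : source + noise := inl (source_of (tagnat.sig i)).
Definition joint_noise (i : 'I_n) : source + noise := inr (tagnat.sig i).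
Definition indiv_source d (b : 'I_(m d)) : source + noise :=
  inl (inr (Tagged (fun d => 'I_(m d)) b)).
Definition indiv_noise d (b : 'I_(m d)) : source + noise :=
  inr (Tagged (fun d => 'I_(c + m d)) (rshift c b)).

Definition indiv_density d : 'cV[R]_(m d) -> R :=
  noisy_density P X sigma (@indiv_source d).

Definition joint_density : 'cV[R]_n -> R := noisy_density P X sigma joint_source.

Lemma indiv_density_is_density d :
  is_density P (noisy_individual s eps d) (@indiv_density d).
Proof.
have -> : noisy_individual s eps d =
    (fun w => cv_of X (@indiv_source d) w + cv_of X (@indiv_noise d) w).
  by apply/funext => w; apply/colP => b; rewrite !mxE.
apply: noisy_density_is_density => //.
- move=> a b ab.
  (* The function reads the index back, which gives injectivity; its [else] branch is a default that
     is never reached. *)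
  have /eqP := congr1 (fun j : source + noise =>
    if j is inr k then k else Tagged (fun d => 'I_(c + m d)) (rshift c a)) ab.
  by rewrite eq_Tagged/= => /eqP/rshift_inj.
- by move=> b; case: model => _ + _ _ _; exact.
Qed.

Lemma mxcol_sig (z : forall d, 'cV[R]_(c + m d)) (i : 'I_n) :
  (\mxcol_d z d) i 0 = z (tag (tagnat.sig i)) (tagged (tagnat.sig i)) 0.
Proof. by rewrite mxE. Qed.

Lemma joint_density_is_density :
  is_density P (fun w => \mxcol_d (stilde s0 s d w + eps d w)) joint_density.
Proof.
have -> : (fun w => \mxcol_d (stilde s0 s d w + eps d w)) =
    (fun w => cv_of X joint_source w + cv_of X joint_noise w).
  apply/funext => w; apply/colP => i; rewrite mxcol_sig !mxE.
  congr (_ + _); rewrite /joint_source /source_of /=.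
  by case: fintype.split.
apply: noisy_density_is_density => //.
- move=> i j ij; apply: (can_inj tagnat.sigK).
  exact: (congr1 (fun k : source + noise =>
    if k is inr l then l else tagnat.sig i) ij).
- by move=> i; case: model => _ + _ _ _; exact.
Qed.

Lemma observation_density (W : forall d, 'M[R]_(c + m d)) :
  (forall d, W d \in unitmx) ->
  is_density P (observation s0 s eps (fun d => invmx (W d)))
    (fun x => `|\det (\mxdiag_d W d)| * joint_density (\mxdiag_d W d *m x)).
Proof.
move=> Wu; have Wdu := unitmx_mxdiag Wu.
have -> : observation s0 s eps (fun d => invmx (W d)) =
    (fun w => invmx (\mxdiag_d W d) *m \mxcol_d (stilde s0 s d w + eps d w)).
  apply/funext => w; rewrite -[LHS](mulKmx Wdu); congr (_ *m _).
  by rewrite mul_mxdiag_mxcol; apply: eq_mxcol => d; rewrite mulKVmx.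
exact: is_density_invmx joint_density_is_density.
Qed.

(** The density at [z] of [D] copies of [s0] with independent Gaussian noises, written as an
    expectation and so without reference to [pS0]. *)
Definition shared_density (z : 'I_D -> 'cV[R]_c) : R :=
  fine (\int[P]_w (\prod_a \prod_d normal_pdf (s0 w a 0%R) sigma (z d a 0%R))%:E).

Let shared_prodE (v : 'cV[R]_c) (z : 'I_D -> 'cV[R]_c) :
  \prod_a \prod_d normal_pdf (v a 0) sigma (z d a 0) =
  normal_peak sigma ^+ (c * D) * expR (- ((2 * sigma ^+ 2)^-1 * scatter z)) *
  expR (- (D%:R * enorm (v - D%:R^-1 *: \sum_d z d) ^+ 2 / (2 * sigma ^+ 2))).
Proof.
rewrite pair_bigA/= (prod_normal_pdfE sigma_gt0 (fun ad => v ad.1 0) (fun ad => z ad.2 ad.1 0)).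
rewrite card_prod !card_ord -mulrA -expRD -expR_sum; congr (_ * expR _).
rewrite sumrN -mulr_sumr.
rewrite -(pair_bigA _ (fun a d => (z d a 0 - v a 0) ^+ 2))/= sum_sqr_dist//.
by field; rewrite gt_eqF.
Qed.

Let shared_prod_gt0 (z : 'I_D -> 'cV[R]_c) (v : 'cV[R]_c) :
  0 < \prod_a \prod_d normal_pdf (v a 0) sigma (z d a 0).
Proof. by apply: prodr_gt0 => a _; apply: prodr_gt0 => d _; exact: normal_pdf_gt0. Qed.

Let measurable_shared_prod (z : 'I_D -> 'cV[R]_c) :
  measurable_fun setT (fun v : 'cV[R]_c =>
    \prod_a \prod_d normal_pdf (v a 0) sigma (z d a 0)).
Proof.
apply: measurable_prod => a _; apply: measurable_prod => d _.
exact: (measurableT_comp (measurable_normal_pdf_mean sigma_gt0 (z d a 0))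
  (@measurable_entry _ R _ _ a ord0)).
Qed.

Let shared_int_bounds (z : 'I_D -> 'cV[R]_c) :
  (0 < \int[P]_w (\prod_a \prod_d normal_pdf (s0 w a 0%R) sigma (z d a 0%R))%:E < +oo)%E.
Proof.
have ms : measurable_fun setT (fun w =>
    \prod_a \prod_d normal_pdf (s0 w a 0) sigma (z d a 0)).
  exact: (measurableT_comp (measurable_shared_prod z) (measurable_funP s0)).
apply/andP; split; first exact: expectation_gt0.
apply: (@le_lt_trans _ _ (\int[P]_w (cst (normal_peak sigma ^+ (c * D))%:E w)))%E.
  apply: ge0_le_integral => //.
  - by move=> w _; rewrite lee_fin ltW.
  - exact/measurable_EFinP.
  move=> w _; rewrite lee_fin pair_bigA/=.
  rewrite (prod_normal_pdfE sigma_gt0 (fun ad => s0 w ad.1 0) (fun ad => z ad.2 ad.1 0)).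
  rewrite card_prod !card_ord ger_pMr; last by rewrite exprn_gt0 ?normal_peak_gt0 ?gt_eqF.
  apply: prodr_ile1 => ad; rewrite expR_ge0 expR_le1 oppr_le0.
  by rewrite mulr_ge0 ?sqr_ge0// invr_ge0 mulr_ge0 ?sqr_ge0.
by rewrite integral_cst//= probability_setT mule1 ltry.
Qed.

Lemma shared_density_fin z : (shared_density z)%:E =
  (\int[P]_w (\prod_a \prod_d normal_pdf (s0 w a 0%R) sigma (z d a 0%R))%:E)%E.
Proof.
have /andP[lb ub] := shared_int_bounds z.
by rewrite /shared_density fineK// ge0_fin_numE// ltW.
Qed.

Lemma shared_density_gt0 z : 0 < shared_density z.
Proof. by rewrite -lte_fin shared_density_fin; case/andP: (shared_int_bounds z). Qed.

Lemma indiv_density_gt0 d z : 0 < @indiv_density d z.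
Proof. exact: noisy_density_gt0. Qed.

(** The expectation over [s0] becomes an integral against [pS0], and completing the square leaves
    only the Gaussian around the mean of the [z d] under that integral. *)
Lemma shared_densityE (pS0 : 'cV[R]_c -> R) z : is_density P s0 pS0 ->
  shared_density z =
  normal_peak sigma ^+ (c * D) * expR (- ((2 * sigma ^+ 2)^-1 * scatter z)) *
  shared_factor D sigma pS0 (D%:R^-1 *: \sum_d z d).
Proof.
move=> [mp p0 pE].
set C := normal_peak sigma ^+ (c * D) * _.
have C0 : 0 < C by rewrite mulr_gt0 ?expR_gt0// exprn_gt0 ?normal_peak_gt0 ?gt_eqF.
pose q (v : 'cV[R]_c) := \prod_a \prod_d normal_pdf (v a 0) sigma (z d a 0).
pose g (v : 'cV[R]_c) :=
  expR (- (D%:R * enorm (v - D%:R^-1 *: \sum_d z d) ^+ 2 / (2 * sigma ^+ 2))).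
have qE v : q v = C * g v by exact: shared_prodE.
have gE v : g v = C^-1 * q v by rewrite qE mulKf ?gt_eqF.
have mg : measurable_fun setT g.
  rewrite (_ : g = fun v => C^-1 * q v); last exact/funext.
  by apply: measurable_funM; [exact: measurable_cst|exact: measurable_shared_prod].
have gp0 v : 0 <= g v * pS0 v by rewrite mulr_ge0// expR_ge0.
have mgp : measurable_fun setT (fun v => g v * pS0 v) by exact: measurable_funM.
have intE : (\int[P]_w (q (s0 w))%:E = C%:E * \int[lebesgue_cv c]_v (g v * pS0 v)%:E)%E.
  rewrite -(ge0_integral_distribution s0 (f := fun v => (q v)%:E)); last 2 first.
  - by apply/measurable_EFinP; exact: measurable_shared_prod.
  - by move=> v; rewrite lee_fin ltW// shared_prod_gt0.
  rewrite (ge0_integral_density (nu := distribution P s0) mp p0 pE); last 2 first.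
  - by apply/measurable_EFinP; exact: measurable_shared_prod.
  - by move=> v; rewrite lee_fin ltW// shared_prod_gt0.
  rewrite -ge0_integralZl//.
  - by apply: eq_integral => v _; rewrite -!EFinM qE mulrA.
  - exact/measurable_EFinP.
  - by move=> v _; rewrite lee_fin.
  - by rewrite lee_fin ltW.
(* [shared_factor] is a real-valued integral, hence [fine] of an extended one; finiteness is
   inherited from the bounded expectation, as [C] is positive. *)
have fin : (\int[lebesgue_cv c]_v (g v * pS0 v)%:E)%E \is a fin_num.
  rewrite ge0_fin_numE; last by apply: integral_ge0 => v _; rewrite lee_fin.
  rewrite ltNge leye_eq; apply/negP => /eqP intoo.
  have := shared_int_bounds z.
  by rewrite [X in (_ < X < _)%E]intE intoo gt0_muley ?lte_fin// ltxx andbF.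
apply: EFin_inj; rewrite shared_density_fin [LHS]intE [RHS]EFinM; congr (_ * _)%E.
by rewrite /shared_factor /Rintegral fineK.
Qed.

(** The product over all components is regrouped by source: a shared source collects one factor from
    each view, an individual source a single factor. Independence of the sources factors the
    expectation, and the factors are reassembled into a shared part and one part per view. *)
Lemma joint_densityE (z : forall d, 'cV[R]_(c + m d)) :
  joint_density (\mxcol_d z d) =
  shared_density (fun d => usubmx (z d)) *
  \prod_d indiv_density (dsubmx (z d)).
Proof.
have mX := measurable_X.
apply: EFin_inj; rewrite EFinM -prodEFin shared_density_fin.
rewrite /joint_density noisy_densityE//.
pose f (j : source) (x : R) := match j with
  | inl a => \prod_d normal_pdf x sigma (usubmx (z d) a 0)
  | inr db => normal_pdf x sigma (dsubmx (z (tag db)) (tagged db) 0)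
  end.
have mf j : measurable_fun setT (f j).
  case: j => [a|db] /=; last exact: measurable_normal_pdf_mean.
  by apply: measurable_prod => d _; exact: measurable_normal_pdf_mean.
have f0 j x : 0 <= f j x.
  case: j => [a|db] /=; last exact: normal_pdf_ge0.
  by apply: prodr_ge0 => d _; exact: normal_pdf_ge0.
transitivity (\int[P]_w (\prod_(j : source) f j (X (inl j) w))%:E)%E.
  apply: eq_integral => w _; congr (_%:E).
  rewrite big_sumType/= exchange_big/=.
  transitivity (\prod_(i : 'I_n) normal_pdf (X (inl (source_of (tagnat.sig i))) w) sigma
      (z (tag (tagnat.sig i)) (tagged (tagnat.sig i)) 0)).
    by apply: eq_bigr => i _; rewrite mxcol_sig.
  (* The flat index of the stacked vector is replaced by a pair of a view and a component. *)
  rewrite -(reindex (F := fun k : noise => normal_pdf (X (inl (source_of k)) w) sigma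
    (z (tag k) (tagged k) 0)) _ tagnat.sig_bij_on)/=.
  transitivity (\prod_d \prod_(j < c + m d) normal_pdf
    (X (inl (source_of (Tagged (fun d => 'I_(c + m d)) j))) w) sigma (z d j 0)).
    by rewrite sig_big_dep; apply: eq_bigr => -[].
  have -> : \prod_(db : {d : 'I_D & 'I_(m d)}) normal_pdf (s (tag db) w (tagged db) 0)
      sigma (dsubmx (z (tag db)) (tagged db) 0) =
      \prod_d \prod_(b < m d) normal_pdf (s d w b 0) sigma (dsubmx (z d) b 0).
    by rewrite sig_big_dep.
  rewrite -big_split/=.
  apply: eq_bigr => d _; rewrite big_split_ord/=.
  congr (_ * _); apply: eq_bigr => a _; rewrite mxE /source_of /=.
    by rewrite (unsplitK (inl a)).
  by rewrite (unsplitK (inr a)).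
rewrite (ge0_expectation_prod_inj mX indX (@inl_inj _ _))// big_sumType/=.
congr (_ * _)%E.
  (* The product formula is used backwards to reunite the shared sources in one expectation. *)
  rewrite -(ge0_expectation_prod_inj (h := fun a => inl (inl a))
    (f := fun a => f (inl a)) mX indX)//.
  by move=> a b [].
transitivity (\prod_d \prod_(b < m d) \int[P]_w (normal_pdf (s d w b 0%R) sigma
    (dsubmx (z d) b 0%R))%:E)%E.
  by rewrite sig_big_dep.
apply: eq_bigr => d _.
rewrite /indiv_density noisy_densityE//.
rewrite (ge0_expectation_prod_inj (h := @indiv_source d)
    (f := fun b x => normal_pdf x sigma (dsubmx (z d) b 0)) mX indX)//.
- move=> a b ab.
  have /eqP := congr1 (fun j : source + noise =>
    if j is inl (inr k) then k else Tagged (fun d => 'I_(m d)) a) ab.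
  by rewrite eq_Tagged/= => /eqP.
- by move=> b; exact: measurable_normal_pdf_mean.
- by move=> b x; exact: normal_pdf_ge0.
Qed.

Lemma joint_density_gt0 z : 0 < joint_density z.
Proof. exact: noisy_density_gt0. Qed.

Lemma lipschitz_joint_density : lipschitz_cv joint_density.
Proof. exact: lipschitz_noisy_density. Qed.

Lemma continuous_indiv_density d : continuous (@indiv_density d).
Proof. by apply: lipschitz_cv_continuous; exact: lipschitz_noisy_density. Qed.

(** An empty product, in accord with the convention on [pZ] when [k_d = c]. *)
Lemma indiv_density_dim0 d z : m d = 0%N -> @indiv_density d z = 1.
Proof.
move=> md0; apply: EFin_inj; rewrite /indiv_density noisy_densityE//.
rewrite (eq_integral (cst 1%E)).
  by rewrite integral_cst//= probability_setT mule1.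
move=> w _; rewrite big1// => i _.
by exfalso; have := ltn_ord i; rewrite [X in (_ < X)%N]md0.
Qed.

End model_density.

Lemma sum_scatter_trace {R : realType} {D c : nat} {m : 'I_D -> nat} {N : nat}
    (W : forall d, 'M[R]_(c + m d)) (x : 'I_N -> forall d, 'cV[R]_(c + m d)) :
  \sum_i scatter (fun d => z_shared W x d i) =
  \sum_(d < D) (\tr (Z_shared W x d *m (Z_shared W x d)^T) -
     1 / D%:R * \sum_(l < D) \tr (Z_shared W x d *m (Z_shared W x l)^T)).
Proof.
have trE d l : \tr (Z_shared W x d *m (Z_shared W x l)^T) =
    \sum_i dot (z_shared W x d i) (z_shared W x l i).
  rewrite /mxtrace /dot [RHS]exchange_big/=; apply: eq_bigr => a _.
  by rewrite mxE; apply: eq_bigr => i _; rewrite !mxE.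
rewrite /scatter exchange_big/=; apply: eq_bigr => d _.
rewrite sumrB trE -mulr_sumr; congr (_ - _ * _).
by rewrite exchange_big/=; apply: eq_bigr => l _; rewrite trE.
Qed.

Theorem mainTheorem2 (R : realType) (D c : nat) (m : 'I_D -> nat) (sigma : R)
    (D_gt0 : (0 < D)%N) (c_gt0 : (0 < c)%N) (sigma_gt0 : 0 < sigma)
    (dO : measure_display) (Omega : measurableType dO) (P : probability Omega R)
    (s0 : {RV P >-> 'cV[R]_c}) (s : forall d, {RV P >-> 'cV[R]_(m d)})
    (eps : forall d, {RV P >-> 'cV[R]_(c + m d)})
    (model : multiview_model s0 s eps sigma)
    (pS0 : 'cV[R]_c -> R) (pS0_density : is_density P s0 pS0)
    (pZ : forall d, 'cV[R]_(m d) -> R)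
    (pZ_density : forall d, (0 < m d)%N ->
      is_density P (noisy_individual s eps d) (pZ d))
    (pZ_trivial : forall d, m d = 0%N -> forall z, pZ d z = 1)
    (pX : (forall d, 'M[R]_(c + m d)) -> 'cV[R]_(\sum_d (c + m d)) -> R)
    (pX_density : forall W : forall d, 'M[R]_(c + m d),
      (forall d, W d \in unitmx) ->
      is_density P (observation s0 s eps (fun d => invmx (W d))) (pX W))
    (N : nat) :
  exists C : R, forall W : forall d, 'M[R]_(c + m d),
    (forall d, W d \in unitmx) ->
    exists E : set 'cV[R]_(\sum_d (c + m d)),
    [/\ (lebesgue_cv (\sum_d (c + m d))).-negligible E,
        continuous (pX W) -> (forall d, continuous (pZ d)) -> E = set0 &
        forall x : 'I_N -> forall d, 'cV[R]_(c + m d),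
          (forall i, ~ E (\mxcol_d x i d)) ->
          log_likelihood (pX W) x =
          \sum_(i < N) (ln (shared_factor D sigma pS0 (sbar W x i)) +
                        \sum_(d < D) ln (pZ d (z_individual W x d i)))
          - 1 / (2 * sigma ^+ 2) *
            \sum_(d < D)
              (\tr (Z_shared W x d *m (Z_shared W x d)^T) -
               1 / D%:R *
               \sum_(l < D) \tr (Z_shared W x d *m (Z_shared W x l)^T))
          + N%:R * \sum_(d < D) ln `|\det (W d)| + C].
Proof.
(* The normalizing constants of the [c * D] Gaussian factors of the shared part, once per sample;
   those of the individual parts are contained in [pZ]. *)
exists (N%:R * ln (normal_peak sigma ^+ (c * D))) => W Wu.
pose Wd := \mxdiag_d W d.
have Wdu : Wd \in unitmx by exact: unitmx_mxdiag.
have detWd : 0 < `|\det Wd| by rewrite normr_gt0 -unitfE -unitmxE.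
pose q x := `|\det Wd| *
  joint_density (sigma := sigma) (s0 := s0) (s := s) (eps := eps) (Wd *m x).
pose h d := @indiv_density R D c m sigma dO Omega P s0 s eps d.
pose indiv d (x : 'cV[R]_(\sum_d (c + m d))) : 'cV[R]_(m d) :=
  dsubmx (W d *m submxcol x d).
pose obs := observation s0 s eps (fun d => invmx (W d)).
have qdens : is_density P obs q by exact: (observation_density sigma_gt0 model Wu).
have hdens d : is_density P (noisy_individual s eps d) (h d).
  exact: (indiv_density_is_density sigma_gt0 model).
have [mq q0 qE] := qdens.
have [mpX _ _] := pX_density W Wu.
have mh d : measurable_fun setT (h d) by case: (hdens d).
have hZ0 d : m d = 0%N -> pZ d = h d.
  move=> md0; apply/funext => z.
  by rewrite pZ_trivial// /h indiv_density_dim0.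
have mpZ d : measurable_fun setT (pZ d).
  have [md0|md0] := posnP (m d); first by rewrite hZ0.
  by case: (pZ_density d md0).
have q_gt0 x : 0 < q x.
  by rewrite mulr_gt0//; exact: (joint_density_gt0 sigma_gt0).
pose bad d := [set z | pZ d z != h d z].
have mbad d : measurable (bad d) by exact: (measurable_neq_fun (mpZ d) (mh d)).
have bad0 d : lebesgue_cv (m d) (bad d) = 0%E.
  have [md0|md0] := posnP (m d).
    rewrite (_ : bad d = set0) ?measure0//; apply/seteqP; split=> z //.
    by rewrite /bad /= hZ0// eqxx.
  exact: (is_density_ae_unique (pZ_density d md0) (hdens d)).
have m_indiv d : measurable_fun setT (indiv d).
  apply/measurable_fun_matrixP => i j.
  have msub : measurable_fun setT
      (fun x : 'cV[R]_(\sum_d (c + m d)) => submxcol x d).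
    apply/measurable_fun_matrixP => k l.
    apply: eq_measurable_fun (@measurable_entry _ R _ _ (tagnat.Rank d k) l) => x _.
    by rewrite mxE.
  apply: eq_measurable_fun (measurableT_comp
    (@measurable_entry _ R _ _ (rshift c i) j)
    (measurableT_comp (measurable_mulmx (W d)) msub)) => x _.
  by rewrite /= [in RHS]mxE.
have indiv_obs d w : indiv d (obs w) = noisy_individual s eps d w.
  rewrite /indiv /obs /observation mxcolK mulKVmx//.
  by rewrite linearD/= /stilde col_mxKd.
have mpre d : measurable (indiv d @^-1` bad d).
  by rewrite -[X in measurable X]setTI; exact: (m_indiv d measurableT _ (mbad d)).
(* The values of [noisy_individual] are bad with probability 0, and the observation has the positive
   density [q], so the pulled-back bad set is Lebesgue null. *)
have pre0 d : lebesgue_cv (\sum_d (c + m d)) (indiv d @^-1` bad d) = 0%E.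
  apply: (null_set_of_integral_eq0 mq q_gt0) => //; rewrite -qE//.
  have -> : obs @^-1` (indiv d @^-1` bad d) = noisy_individual s eps d @^-1` bad d.
    by apply/seteqP; split=> w; rewrite /= indiv_obs.
  have [_ _ ->//] := hdens d.
  apply: null_set_integral; [exact: mbad| |exact: bad0].
  by apply/measurable_EFinP; apply: measurable_funTS; exact: mh.
(* Outside this set, [pX W] and every [pZ d] take the values of the explicit versions [q] and
   [h d]. *)
exists [set x | pX W x != q x \/ exists d, bad d (indiv d x)]; split.
(* The finitely many views are padded by the empty set to a sequence, to form a countable union. *)
- pose F k := if insub k is Some d then indiv d @^-1` bad d else set0.
  apply: (@negligibleS _ _ _ _ ([set x | pX W x != q x] `|` \bigcup_k F k)).
    move=> x /= [pXq|[d bd]]; [by left|right].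
    by exists d => //; rewrite /F valK.
  apply: negligibleU.
    apply/negligibleP; first exact: (measurable_neq_fun mpX mq).
    exact: (is_density_ae_unique (pX_density W Wu) qdens).
  apply: negligible_bigcup => k; rewrite /F; case: insubP => [d _ _|_].
    by apply/negligibleP; [exact: mpre|exact: pre0].
  exact: negligible_set0.
(* The versions [q] and [h d] are Lipschitz, hence continuous, so almost everywhere agreement
   becomes agreement everywhere. *)
- move=> cpX cpZ; apply/seteqP; split=> // x /= [/eqP[]|[d /eqP[]]].
    apply: continuous_ae_eq => //; first exact: (measurable_neq_fun mpX mq).
      apply: lipschitz_cv_continuous; apply: lipschitz_cv_mulmx => //.
      exact: (lipschitz_joint_density sigma_gt0).
    exact: (is_density_ae_unique (pX_density W Wu) qdens).
  have ch : continuous (h d) by exact: (continuous_indiv_density sigma_gt0).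
  exact: (continuous_ae_eq (mbad d) (cpZ d) ch (bad0 d)).
move=> x xE.
have term i : ln (pX W (\mxcol_d x i d)) =
    ln (shared_factor D sigma pS0 (sbar W x i)) +
    \sum_(d < D) ln (pZ d (z_individual W x d i)) -
    1 / (2 * sigma ^+ 2) * scatter (fun d => z_shared W x d i) +
    \sum_(d < D) ln `|\det (W d)| + ln (normal_peak sigma ^+ (c * D)).
  have /not_orP[/negP/negPn/eqP -> nbad] := xE i.
  have pZh d : pZ d (z_individual W x d i) = h d (z_individual W x d i).
    apply/eqP/negPn/negP => bd; apply: nbad; exists d.
    by rewrite /bad /indiv /= mxcolK.
  under eq_bigr do rewrite pZh.
  rewrite /q /Wd mul_mxdiag_mxcol (joint_densityE sigma_gt0 model).
  have shE := shared_densityE D_gt0 sigma_gt0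
    (fun d => usubmx (W d *m x i d)) pS0_density.
  have sh0 := shared_density_gt0 sigma_gt0 (s0 := s0)
    (fun d => usubmx (W d *m x i d)).
  have peak0 : 0 < normal_peak sigma ^+ (c * D).
    by rewrite exprn_gt0// normal_peak_gt0// gt_eqF.
  have h0 d z : 0 < h d z by exact: (indiv_density_gt0 sigma_gt0).
  (* Positivity is read off from that of the expectation, a positive multiple of [shared_factor]. *)
  have sf0 : 0 < shared_factor D sigma pS0 (sbar W x i).
    by move: sh0; rewrite shE pmulr_rgt0// mulr_gt0// expR_gt0.
  rewrite lnM ?posrE ?mulr_gt0 ?prodr_gt0//.
  rewrite lnM ?posrE ?prodr_gt0//.
  rewrite shE lnM ?posrE ?mulr_gt0 ?expR_gt0// lnM ?posrE ?expR_gt0// expRK.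
  rewrite det_mxdiag normr_prod !ln_prod//; last first.
    by move=> d; rewrite normr_gt0 -unitfE -unitmxE.
  rewrite mul1r; ring.
rewrite /log_likelihood -sum_scatter_trace; under eq_bigr do rewrite term.
by rewrite !big_split/= sumrN -mulr_sumr !sumr_const card_ord !mulr_natl.
Qed.
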